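(* Let $(X_n)_{n\ge1}$ be mean zero, independent, identically distributed random vectors in $\mathbb{R}^d$ with an isotropic distribution. There exists $T>0$, depending on the distribution of $X_1$, with the following property: for every random vector $X$ in $\mathbb{R}^d$ independent of $(X_n)_{n\ge1}$ whose characteristic function $f(t)=\mathbb{E}\,e^{i\langle t,X\rangle}$, $t\in\mathbb{R}^d$, is supported on the ball $\{|t|\le T\}$, the random vectors $Z_n=\frac{1}{\sqrt n}(X+X_1+\dots+X_n)$ have continuous densities $p_n$ such that $$\sup_{x\in\mathbb{R}^d}|p_n(x)-\varphi(x)|\to0\quad\text{as } n\to\infty.$$ Moreover: (a) if $\beta_3=\sup_{|\theta|=1}\mathbb{E}\,|\langle X_1,\theta\rangle|^3$ is finite, one may take $T=1/\beta_3$; (b) if $X_1$ has a non-lattice distribution, $T>0$ may be arbitrary.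
   Context: $\langle\cdot,\cdot\rangle$ and $|\cdot|$ are the canonical inner product and Euclidean norm in $\mathbb{R}^d$. A random vector $Y$ in $\mathbb{R}^d$ has an isotropic distribution if $\mathbb{E}\langle Y,\theta\rangle^2=|\theta|^2$ for all $\theta\in\mathbb{R}^d$. $\varphi(x)=(2\pi)^{-d/2}e^{-|x|^2/2}$, $x\in\mathbb{R}^d$, is the standard normal density. ''$f$ is supported on $\{|t|\le T\}$'' means $f(t)=0$ whenever $|t|>T$. ''$X_1$ has a non-lattice distribution'' means that $|\mathbb{E}\,e^{i\langle t,X_1\rangle}|<1$ for all $t\in\mathbb{R}^d$, $t\neq0$; equivalently, for no unit vector $\theta$ is the distribution of $\langle X_1,\theta\rangle$ supported on a set of the form $a+h\mathbb{Z}$ with $a\in\mathbb{R}$, $h>0$. *)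

(* Defs.v *)
From HB Require Import structures.
From mathcomp Require Import all_boot all_order all_algebra finmap.
From mathcomp Require Import all_classical all_reals all_analysis.
From mathcomp Require Import complex.

Set Implicit Arguments.
Unset Strict Implicit.
Unset Printing Implicit Defensive.

Import Order.TTheory GRing.Theory Num.Theory.
Import numFieldNormedType.Exports.

Local Open Scope classical_set_scope.
Local Open Scope ring_scope.

(* R^d is 'rV[R]_d, with its library topology and with the sigma-algebra
   generated by the coordinates, i.e. the Borel sigma-algebra. *)
Definition rV_display : measure_display -> measure_display.
Proof. exact. Qed.

Section measurable_rV.
Context (R : realType) (d : nat).

Let coord (i : 'I_d) (x : 'rV[R]_d) : R := x ord0 i.

Let rV_set0 : g_sigma_preimage coord set0.
Proof. exact: sigma_algebra0. Qed.

Let rV_setC A : g_sigma_preimage coord A -> g_sigma_preimage coord (~` A).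
Proof. exact: sigma_algebraC. Qed.

Let rV_bigcup (F : (set 'rV[R]_d)^nat) :
  (forall i, g_sigma_preimage coord (F i)) ->
  g_sigma_preimage coord (\bigcup_i F i).
Proof. exact: sigma_algebra_bigcup. Qed.

HB.instance Definition _ := @isMeasurable.Build (rV_display default_measure_display)
  'rV[R]_d (g_sigma_preimage coord) rV_set0 rV_setC rV_bigcup.

Lemma measurable_coord (i : 'I_d) :
  measurable_fun [set: 'rV[R]_d] (fun x => x ord0 i).
Proof.
move=> _ Y mY; rewrite setTI; apply: sub_sigma_algebra => /=.
rewrite -bigcup_seq/=; exists i => /=; first by rewrite mem_index_enum.
by exists Y => //; rewrite setTI.
Qed.

Lemma measurable_fun_rV d' (T : measurableType d') (f : T -> 'rV[R]_d) :
  (forall i, measurable_fun [set: T] (fun x => f x ord0 i)) ->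
  measurable_fun [set: T] f.
Proof.
move=> mf _ A; apply: (@smallest_sub _ _ _ [set A | measurable (setT `&` f @^-1` A)]).
  split => /=.
  - by rewrite preimage_set0 setI0.
  - by move=> B; rewrite !setTI setTD preimage_setC; exact: measurableC.
  - move=> F mF; rewrite setTI preimage_bigcup; apply: bigcup_measurable => k _.
    by have := mF k; rewrite setTI.
move=> B; rewrite -bigcup_seq => -[i /= _ [C mC <-]].
by rewrite setTI -comp_preimage; exact: mf.
Qed.

End measurable_rV.

(* Lebesgue measure on R^d: the d-fold product of the one-dimensional one. *)
Section lebesgue_step.
Context (R : realType) (d : nat).

Definition rV_cons (x : R * 'rV[R]_d) : 'rV[R]_d.+1 :=
  row_mx (const_mx x.1 : 'rV[R]_1) x.2.

Definition rV_uncons (v : 'rV[R]_d.+1) : R * 'rV[R]_d :=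
  (v ord0 ord0, \row_i v ord0 (lift ord0 i)).

Lemma rV_consK : cancel rV_cons rV_uncons.
Proof.
case=> a v; rewrite /rV_uncons /rV_cons /=; congr pair.
  have -> : (ord0 : 'I_d.+1) = lshift d (ord0 : 'I_1) by exact/val_inj.
  by rewrite (row_mxEl (const_mx a : 'rV_1)) mxE.
apply/rowP => i; rewrite mxE.
have -> : lift ord0 i = rshift 1 i :> 'I_d.+1 by exact/val_inj.
by rewrite (row_mxEr (const_mx a : 'rV_1)).
Qed.

Lemma measurable_rV_cons : measurable_fun setT rV_cons.
Proof.
apply: measurable_fun_rV => i.
case: (split_ordP (i : 'I_(1 + d))) => j ->.
  rewrite (_ : (fun _ => _) = fst); first exact: measurable_fst.
  by apply/funext => x; rewrite /rV_cons (row_mxEl (const_mx x.1 : 'rV_1)) mxE.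
rewrite (_ : (fun _ => _) = (fun v : 'rV[R]_d => v ord0 j) \o snd).
  by apply: measurableT_comp; [exact: measurable_coord|exact: measurable_snd].
by apply/funext => x; rewrite /rV_cons (row_mxEr (const_mx x.1 : 'rV_1)).
Qed.

Lemma measurable_rV_uncons : measurable_fun setT rV_uncons.
Proof.
apply: measurable_fun_pair; first exact: measurable_coord.
apply: measurable_fun_rV => i.
rewrite (_ : (fun _ => _) = (fun v : 'rV[R]_d.+1 => v ord0 (lift ord0 i))).
  exact: measurable_coord.
by apply/funext => v; rewrite /= mxE.
Qed.

Variable m : {sigma_finite_measure set 'rV[R]_d -> \bar R}.

Definition lebesgue_step : set 'rV[R]_d.+1 -> \bar R :=
  pushforward (@lebesgue_measure R \x m)%E rV_cons.

Let step0 : lebesgue_step set0 = 0%E.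
Proof. by rewrite /lebesgue_step /pushforward preimage_set0 measure0. Qed.

Let step_ge0 A : (0 <= lebesgue_step A)%E.
Proof. by rewrite /lebesgue_step /pushforward; exact: measure_ge0. Qed.

Let step_sigma_additive : semi_sigma_additive lebesgue_step.
Proof.
move=> F mF tF mUF.
pose mstep : {measure set _ -> \bar R} :=
  measure_function_pushforward__canonical__measure_function_Measure
   (@lebesgue_measure R \x m)%E measurable_rV_cons.
exact: (@measure_semi_sigma_additive _ _ _ mstep).
Qed.

HB.instance Definition _ := isMeasure.Build _ _ _
  lebesgue_step step0 step_ge0 step_sigma_additive.

Let step_sigma_finite : sigma_finite setT lebesgue_step.
Proof.
have /sigma_finiteP[F [TF ndF Foo]] := sigma_finiteT (@lebesgue_measure R).
have /sigma_finiteP[G [TG ndG Goo]] := sigma_finiteT m.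
exists (fun k => rV_uncons @^-1` (F k `*` G k)).
  apply/esym; rewrite -subTset => v _ /=.
  have [i _ Fi] : (\bigcup_i F i) (rV_uncons v).1 by rewrite -TF.
  have [j _ Gj] : (\bigcup_j G j) (rV_uncons v).2 by rewrite -TG.
  exists (maxn i j) => //; split.
    by move: Fi; exact/subsetPset/ndF/leq_maxl.
  by move: Gj; exact/subsetPset/ndG/leq_maxr.
move=> k; have [mF Fk] := Foo k; have [mG Gk] := Goo k; split.
  rewrite -[X in measurable X]setTI; apply: measurable_rV_uncons => //.
  exact: measurableX.
rewrite /lebesgue_step /pushforward -comp_preimage.
rewrite (_ : _ \o _ = id) ?preimage_id; last first.
  by apply/funext => x /=; rewrite rV_consK.
by rewrite product_measure1E// lte_mul_pinfty// ge0_fin_numE.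
Qed.

HB.instance Definition _ := @Measure_isSigmaFinite.Build _ _ _
  lebesgue_step step_sigma_finite.

End lebesgue_step.

Fixpoint lebesgue_rV (R : realType) (d : nat) :
    {sigma_finite_measure set 'rV[R]_d -> \bar R} :=
  match d with
  | 0%N => \d_(0 : 'rV[R]_0)
  | d'.+1 => lebesgue_step (lebesgue_rV R d')
  end.

Lemma measurable_box (R : realType) (d : nat) (A : 'I_d -> set R) :
  (forall i, measurable (A i)) ->
  measurable [set v : 'rV[R]_d | forall i, A i (v ord0 i)].
Proof.
move=> mA; rewrite (_ : [set _ | _] =
    \bigcap_(i in [set: 'I_d]) ((fun v : 'rV[R]_d => v ord0 i) @^-1` A i)).
  apply: fin_bigcap_measurable; first exact: finite_finset.
  move=> i _; rewrite -[X in measurable X]setTI.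
  exact: measurable_coord.
by apply/seteqP; split=> v /= Av i; [move=> _|]; exact: Av.
Qed.

Lemma lebesgue_rV_box (R : realType) (d : nat) (A : 'I_d -> set R) :
  (forall i, measurable (A i)) ->
  lebesgue_rV R d [set v : 'rV[R]_d | forall i, A i (v ord0 i)] =
  (\prod_(i < d) lebesgue_measure (A i))%E.
Proof.
elim: d A => [|d IHd] A mA.
  by rewrite big_ord0 /= diracE mem_set//= => -[[]].
have cons0 (x : R * 'rV[R]_d) : rV_cons x ord0 ord0 = x.1.
  by rewrite -[in RHS](rV_consK x).
have consS (x : R * 'rV[R]_d) i : rV_cons x ord0 (lift ord0 i) = x.2 ord0 i.
  by rewrite -[in RHS](rV_consK x) [RHS]mxE.
rewrite big_ord_recl /= /lebesgue_step /pushforward.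
rewrite (_ : _ @^-1` _ =
    A ord0 `*` [set v : 'rV[R]_d | forall i, A (lift ord0 i) (v ord0 i)]).
  rewrite product_measure1E; [|exact: mA|].
    by congr (_ * _)%E; exact: (IHd (fun i => A (lift ord0 i))).
  exact: (@measurable_box R d (fun i => A (lift ord0 i))).
apply/seteqP; split=> [x /= Ax|x /= [A0 Ax] i].
  split=> [|i]; first by rewrite -cons0.
  by rewrite -consS.
by have [j ->|->] := unliftP ord0 i; rewrite ?consS ?cons0.
Qed.

(* The library norm on 'rV[R]_d is the max norm, hence these two. *)
Definition dotp (R : realType) (d : nat) (u v : 'rV[R]_d) : R :=
  \sum_(i < d) u ord0 i * v ord0 i.

Definition enorm (R : realType) (d : nat) (u : 'rV[R]_d) : R :=
  Num.sqrt (dotp u u).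

Definition std_normal_pdf (R : realType) (d : nat) (x : 'rV[R]_d) : R :=
  (2 * pi) `^ (- (d%:R / 2)) * expR (- (enorm x ^+ 2 / 2)).

Section random_vectors.
Context (dO : measure_display) (Omega : measurableType dO) (R : realType).
Variables (P : probability Omega R) (d : nat).

Definition mean_zero (Y : {RV P >-> 'rV[R]_d}) : Prop :=
  forall i : 'I_d, P.-integrable setT (EFin \o (fun w => Y w ord0 i)) /\
    ('E_P[fun w => Y w ord0 i] = 0)%E.

Definition isotropic (Y : {RV P >-> 'rV[R]_d}) : Prop :=
  forall theta : 'rV[R]_d,
    ('E_P[fun w => (dotp (Y w) theta ^+ 2)%R] = (enorm theta ^+ 2)%:E)%E.

(* E exp(i <t, Y>), the expectation being taken on real and imaginary parts *)
Definition char_fun (Y : {RV P >-> 'rV[R]_d}) (t : 'rV[R]_d) : R[i] :=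
  Complex (\int[P]_w cos (dotp t (Y w))) (\int[P]_w sin (dotp t (Y w))).

Definition nonlattice (Y : {RV P >-> 'rV[R]_d}) : Prop :=
  forall t : 'rV[R]_d, t != 0 -> `|char_fun Y t| < 1.

Definition beta3 (Y : {RV P >-> 'rV[R]_d}) : \bar R :=
  ereal_sup [set ('E_P[fun w => (`|dotp (Y w) theta| ^+ 3)%R])%E
            | theta in [set theta : 'rV[R]_d | enorm theta = 1]].

Definition mutually_independent (Xs : nat -> {RV P >-> 'rV[R]_d}) : Prop :=
  forall (J : {fset nat}) (A : nat -> set 'rV[R]_d),
    (forall j, measurable (A j)) ->
    P (\bigcap_(j in [set` J]) (Xs j @^-1` A j)) =
    (\prod_(j <- J) P (Xs j @^-1` A j))%E.

(* Y is independent of the sigma-algebra generated by the whole sequence *)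
Definition independent_of_seq (Y : {RV P >-> 'rV[R]_d})
    (Xs : nat -> {RV P >-> 'rV[R]_d}) : Prop :=
  forall (A : set 'rV[R]_d) (B : set Omega),
    measurable A ->
    <<s \bigcup_n preimage_set_system setT (Xs n) measurable >> B ->
    P (Y @^-1` A `&` B) = (P (Y @^-1` A) * P B)%E.

Definition has_density (Z : Omega -> 'rV[R]_d) (p : 'rV[R]_d -> R) : Prop :=
  (forall x, 0 <= p x) /\
  (forall A, measurable A ->
     P (Z @^-1` A) = (\int[lebesgue_rV R d]_(x in A) (p x)%:E)%E).

(* X_1, X_2, ... is represented by Xs 0, Xs 1, ... *)
Definition normalized_sum (Y : {RV P >-> 'rV[R]_d})
    (Xs : nat -> {RV P >-> 'rV[R]_d}) (n : nat) (w : Omega) : 'rV[R]_d :=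
  (Num.sqrt n%:R)^-1 *: (Y w + \sum_(k < n) Xs k w).

End random_vectors.

Definition same_law (dO dO' : measure_display) (Omega : measurableType dO)
    (Omega' : measurableType dO') (R : realType) (P : probability Omega R)
    (P' : probability Omega' R) (d : nat)
    (Y : {RV P >-> 'rV[R]_d}) (Y' : {RV P' >-> 'rV[R]_d}) : Prop :=
  forall A, measurable A -> distribution P Y A = distribution P' Y' A.

(* T is an admissible radius for the distribution of X1. The sequence and the
   vector Y live on an arbitrary probability space, which need not be the one
   carrying X1: T depends on the distribution of X1 only, and the original space
   may be too small to carry any suitable Y. *)
Definition smoothing_radius (dO : measure_display) (Omega : measurableType dO)
    (R : realType) (P : probability Omega R) (d : nat)
    (X1 : {RV P >-> 'rV[R]_d}) (T : R) : Prop :=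
  forall (dO' : measure_display) (Omega' : measurableType dO')
    (P' : probability Omega' R)
    (Xs : nat -> {RV P' >-> 'rV[R]_d}) (Y : {RV P' >-> 'rV[R]_d}),
    mutually_independent Xs ->
    (forall n, same_law (Xs n) X1) ->
    independent_of_seq Y Xs ->
    (forall t : 'rV[R]_d, T < enorm t -> char_fun Y t = 0) ->
    exists p : nat -> 'rV[R]_d -> R,
      (forall n, (0 < n)%N ->
         continuous (p n) /\ has_density P' (normalized_sum Y Xs n) (p n)) /\
      (ereal_sup [set `|p n x - std_normal_pdf x|%:E | x in [set: 'rV[R]_d]]
         @[n --> \oo] --> 0%E).

(* Main.v *)
(* Let f1 be the characteristic function of X1. If |f1(t)| <= exp(-c|t|^2) for |t| <= T and
   some c > 0, then T is admissible. Indeed Z_n has the characteristic function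
   f_n(t) = f(t/sqrt n) f1(t/sqrt n)^n, which vanishes for |t| > T sqrt n, so Z_n has the
   density (2 pi)^-d int exp(-i<t,x>) f_n(t) dt. Its distance to phi is at most
   (2 pi)^-d int |f_n(t) - exp(-|t|^2/2)| dt for every x, and this tends to 0 by dominated
   convergence: f_n is bounded by exp(-c|t|^2), and f_n(t) -> exp(-|t|^2/2) by the
   second-order expansion of f1 at 0.

   The Gaussian bound on f1 holds near 0 by the same expansion; on |t| <= 1/beta3 because
   |f1(t) - 1 + |t|^2/2| is controlled by beta3 |t|^3; and, for a non-lattice X1, on every
   ball, because |f1| is bounded away from 1 on compact sets that avoid 0.

   Fourier inversion is obtained by Gaussian smoothing. The density of Z + sN, with N
   standard normal and independent of Z, is E phi_s(x - Z), whose Fourier representation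
   follows from that of phi_s by Fubini; then s -> 0, first pointwise in x and then against
   products of tent functions, which in turn increase to indicators of open boxes. *)
From HB Require Import structures.
Require Import Defs.
From mathcomp Require Import all_boot all_order all_algebra finmap.
From mathcomp Require Import all_classical all_reals all_analysis.
From mathcomp Require Import measurable_realfun complex ring lra.

Set Implicit Arguments.
Unset Strict Implicit.
Unset Printing Implicit Defensive.

Import Order.TTheory GRing.Theory Num.Theory.
Import numFieldNormedType.Exports.

Local Open Scope classical_set_scope.
Local Open Scope ring_scope.

(** * Real-valued Lebesgue integrals *)

(** Compact support of f makes the inversion unconditional: f_n is bounded and vanishes off a ball,
    hence is integrable, whatever |f1| does far from 0. Decay of f1 matters on |t| <= T only, and
    the scaling t -> t/sqrt n turns this ball into one that contains the support of f_n.

    The radius 1/beta3 comes from the second-order Taylor remainder of exp(iu), whose real and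
    imaginary parts are each at most |u|^3/6 in absolute value. Hence |f1(t)| <= 1 - |t|^2/2 + beta3
    |t|^3/3 when |t|^2 <= 2, and beta3 |t| <= 1 leaves exp(-|t|^2/6). The limit of f1(t/sqrt n)^n
    involves no complex logarithm: exp(-|t|^2/2) is the n-th power of exp(-|t|^2/(2n)), and n-th
    powers in the unit disc differ by at most n times the difference of their bases.

    The inverse transform is not visibly nonnegative, nor is its integral over a box visibly a
    probability; both facts are inherited from the smoothed densities. All integrals are real: the
    integrand is the real part of exp(-i<t,x>) f_n(t). *)

Section Rintegral_facts.
Context d (T : measurableType d) (R : realType).
Variable mu : {measure set T -> \bar R}.
Implicit Types f g : T -> R.

Lemma integrable_measurable_real f :
  mu.-integrable setT (EFin \o f) -> measurable_fun setT f.
Proof. by move=> /measurable_int/measurable_EFinP. Qed.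

Lemma le_Rintegrable f g :
  measurable_fun setT f -> (forall x, `|f x| <= g x) ->
  mu.-integrable setT (EFin \o g) -> mu.-integrable setT (EFin \o f).
Proof.
move=> mf fg ig; apply: (le_integrable measurableT _ _ ig).
  exact/measurable_EFinP.
by move=> x _ /=; rewrite lee_fin (le_trans (fg x))// ler_norm.
Qed.

Lemma Rintegral_dominated_cvg (F : nat -> T -> R) f g :
  (forall n, measurable_fun setT (F n)) ->
  (forall x, F n x @[n --> \oo] --> f x) ->
  mu.-integrable setT (EFin \o g) ->
  (forall n x, `|F n x| <= g x) ->
  \int[mu]_x F n x @[n --> \oo] --> \int[mu]_x f x.
Proof.
move=> mF Ff ig Fg.
have mf : measurable_fun setT f.
  by apply: (measurable_fun_cvg mF) => x _; exact: Ff.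
have [||||if_ _ cv] := @dominated_convergence _ _ _ mu setT measurableT
    (fun n => EFin \o F n) (EFin \o f) (EFin \o g) _ _ _ ig.
- by move=> n; exact/measurable_EFinP.
- exact/measurable_EFinP.
- by apply: aeW => x _; apply: cvg_EFin; [exact: nearW|exact: Ff].
- by apply: aeW => x n _; rewrite lee_fin.
apply: fine_cvg; rewrite fineK//.
exact: integrable_fin_num.
Qed.

Lemma EFin_Rintegral f : mu.-integrable setT (EFin \o f) ->
  (\int[mu]_x f x)%:E = (\int[mu]_x (f x)%:E)%E.
Proof. by move=> fi; rewrite fineK//; exact: integrable_fin_num. Qed.

End Rintegral_facts.

Lemma measure_probability_setT d (T : measurableType d) (R : realType)
    (P : probability T R) : (P : {measure set T -> \bar R}) setT = 1%E.
Proof. exact: probability_setT. Qed.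

Lemma integrable_bounded d (T : measurableType d) (R : realType)
    (P : probability T R) (f : T -> R) (M : R) :
  measurable_fun setT f -> (forall x, `|f x| <= M) ->
  P.-integrable setT (EFin \o f).
Proof.
move=> mf fM; apply: (le_Rintegrable mf fM).
apply: measurable_bounded_integrable => //.
  by rewrite measure_probability_setT ltry.
exact: bounded_cst.
Qed.

Lemma Rintegral_probability_cst d (T : measurableType d) (R : realType)
    (P : probability T R) (r : R) : \int[P]_x r = r.
Proof. by rewrite Rintegral_cst// measure_probability_setT mulr1. Qed.

(** * Fubini's theorem and products of integrals *)

Section Fubini_real.
Context d1 d2 (T1 : measurableType d1) (T2 : measurableType d2) (R : realType).

(** Nonnegativity makes Tonelli's measurability statement available without integrability; signed
    integrands are first shifted by an integrable function. *)
Lemma measurable_Rintegral_section (m2 : {sigma_finite_measure set T2 -> \bar R})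
    (f : T1 * T2 -> R) :
  measurable_fun setT f -> (forall z, 0 <= f z) ->
  measurable_fun setT (fun x => \int[m2]_y f (x, y)).
Proof.
move=> mf f0; apply: measurableT_comp => //=.
by apply: (measurable_fun_fubini_tonelli_F (EFin \o f)) => //;
  exact/measurable_EFinP.
Qed.

(** The majorant does not depend on the probability variable and [P] has mass 1, so the double
    integral of |f| is at most the integral of [h]. *)
Lemma Rintegral_Fubini_bounded (P : probability T1 R)
    (m2 : {sigma_finite_measure set T2 -> \bar R})
    (f : T1 * T2 -> R) (h : T2 -> R) :
  measurable_fun setT f -> (forall x y, `|f (x, y)| <= h y) ->
  m2.-integrable setT (EFin \o h) ->
  \int[P]_x \int[m2]_y f (x, y) = \int[m2]_y \int[P]_x f (x, y).
Proof.
move=> mf fh ih.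
have mf1 x : measurable_fun setT (fun y => f (x, y)).
  exact: measurableT_comp.
have mf2 y : measurable_fun setT (fun x => f (x, y)).
  exact: measurableT_comp.
have if1 x : m2.-integrable setT (EFin \o fun y => f (x, y)).
  exact: le_Rintegrable ih.
have if2 y : P.-integrable setT (EFin \o fun x => f (x, y)).
  exact: (integrable_bounded P (mf2 y) (fh ^~ y)).
have if12 : (P \x m2)%E.-integrable setT (EFin \o f).
  apply/integrable21ltyP; first exact/measurable_EFinP.
  apply: (@le_lt_trans _ _ (\int[m2]_y (h y)%:E)%E).
    apply: ge0_le_integral => //.
    - by move=> y _; exact: integral_ge0.
    - apply: (measurable_fun_fubini_tonelli_G (abse \o (EFin \o f))) => //=.
      by apply: measurableT_comp => //; exact/measurable_EFinP.
    - by case/integrableP : ih.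
    - move=> y _; apply: (@le_trans _ _ (\int[P]_x (h y)%:E)%E).
        apply: ge0_le_integral => //.
        + by apply: measurableT_comp => //; exact/measurable_EFinP.
        + by move=> x _; rewrite lee_fin.
      by rewrite integral_cst// measure_probability_setT mule1.
  have := integrable_fin_num measurableT ih.
  by rewrite fin_numE => /andP[_]; rewrite ltey.
have H := Fubini if12.
rewrite /Rintegral; congr fine.
transitivity (\int[P]_x \int[m2]_y (f (x, y))%:E)%E.
  by apply: eq_integral => x _; rewrite -EFin_Rintegral.
by rewrite H; apply: eq_integral => x _; rewrite -[LHS]EFin_Rintegral.
Qed.

Lemma Rintegral_prod (m1 : {sigma_finite_measure set T1 -> \bar R})
    (m2 : {sigma_finite_measure set T2 -> \bar R}) (f : T1 -> R) (g : T2 -> R) :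
  m1.-integrable setT (EFin \o f) -> m2.-integrable setT (EFin \o g) ->
  (m1 \x m2)%E.-integrable setT (EFin \o (fun z => f z.1 * g z.2)) /\
  \int[(m1 \x m2)%E]_z (f z.1 * g z.2) = \int[m1]_x f x * \int[m2]_y g y.
Proof.
move=> if_ ig.
have mf := integrable_measurable_real if_; have mg := integrable_measurable_real ig.
have mfg : measurable_fun setT (fun z : T1 * T2 => f z.1 * g z.2).
  by apply: measurable_funM; apply: measurableT_comp.
have ifg : (m1 \x m2)%E.-integrable setT (EFin \o (fun z => f z.1 * g z.2)).
  apply/integrable12ltyP => /=; first exact/measurable_EFinP.
  rewrite (eq_integral (fun x => (`|f x|)%:E * \int[m2]_y `|(g y)%:E|))%E; last first.
    move=> x _; under eq_integral do rewrite normrM EFinM.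
    rewrite ge0_integralZl//.
    by apply/measurable_EFinP; exact: measurableT_comp.
  have [_ gy] := integrableP _ _ _ ig; have [_ fy] := integrableP _ _ _ if_.
  rewrite ge0_integralZr//.
  - by apply: lte_mul_pinfty => //; [exact: integral_ge0|
      rewrite ge0_fin_numE//; exact: integral_ge0].
  - by apply/measurable_EFinP; exact: measurableT_comp.
  - exact: integral_ge0.
split => //; rewrite /Rintegral -fineM; [|exact: integrable_fin_num..].
congr fine; rewrite -integral12_prod_meas1// /fubini_F.
transitivity (\int[m1]_x ((f x)%:E * \int[m2]_y (g y)%:E))%E.
  apply: eq_integral => x _; rewrite -integralZl//.
by rewrite -(EFin_Rintegral ig); exact: integralZr.
Qed.

End Fubini_real.

(** * Inner product and Lebesgue measure on row vectors *)

Section dotp_theory.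
Context (R : realType) (d : nat).
Implicit Types u v w : 'rV[R]_d.

Lemma dotpC u v : dotp u v = dotp v u.
Proof. by apply: eq_bigr => i _; rewrite mulrC. Qed.

Lemma dotpDr u v w : dotp u (v + w) = dotp u v + dotp u w.
Proof. by rewrite -big_split/=; apply: eq_bigr => i _; rewrite mxE mulrDr. Qed.

Lemma dotpZr a u v : dotp u (a *: v) = a * dotp u v.
Proof. by rewrite mulr_sumr; apply: eq_bigr => i _; rewrite mxE mulrCA. Qed.

Lemma dotpDl u v w : dotp (u + v) w = dotp u w + dotp v w.
Proof. by rewrite !(dotpC _ w) dotpDr. Qed.

Lemma dotpZl a u v : dotp (a *: u) v = a * dotp u v.
Proof. by rewrite !(dotpC _ v) dotpZr. Qed.

Lemma dotpNr u v : dotp u (- v) = - dotp u v.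
Proof. by rewrite -scaleN1r dotpZr mulN1r. Qed.

Lemma dotpBr u v w : dotp u (v - w) = dotp u v - dotp u w.
Proof. by rewrite dotpDr dotpNr. Qed.

Lemma dotpBl u v w : dotp (u - v) w = dotp u w - dotp v w.
Proof. by rewrite !(dotpC _ w) dotpBr. Qed.

Lemma dotp0r u : dotp u 0 = 0.
Proof. by rewrite -(scale0r (0 : 'rV[R]_d)) dotpZr mul0r. Qed.

Lemma dotp0l u : dotp 0 u = 0.
Proof. by rewrite dotpC dotp0r. Qed.

Lemma dotp_ge0 u : 0 <= dotp u u.
Proof. by apply: sumr_ge0 => i _; rewrite -expr2 sqr_ge0. Qed.

Lemma enorm_ge0 u : 0 <= enorm u.
Proof. exact: sqrtr_ge0. Qed.

Lemma sqr_enorm u : enorm u ^+ 2 = dotp u u.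
Proof. by rewrite sqr_sqrtr// dotp_ge0. Qed.

Lemma enorm0 : enorm (0 : 'rV[R]_d) = 0.
Proof. by rewrite /enorm dotp0r sqrtr0. Qed.

Lemma enorm_eq0 u : enorm u = 0 -> u = 0.
Proof.
move=> u0; have : dotp u u = 0 by rewrite -sqr_enorm u0 expr0n.
move/eqP; rewrite psumr_eq0; last by move=> i _; rewrite -expr2 sqr_ge0.
move=> /allP h; apply/rowP => i; rewrite mxE.
by have := h i; rewrite mem_index_enum => /(_ isT) /=; rewrite mulf_eq0 orbb => /eqP.
Qed.

Lemma enormZ a u : enorm (a *: u) = `|a| * enorm u.
Proof.
by rewrite /enorm dotpZl dotpZr mulrA -expr2 sqrtrM ?sqr_ge0// sqrtr_sqr.
Qed.

Lemma abs_coord_le_enorm u i : `|u ord0 i| <= enorm u.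
Proof.
rewrite -sqrtr_sqr ler_wsqrtr// /dotp (bigD1 i)//= expr2 lerDl.
by apply: sumr_ge0 => j _; rewrite -expr2 sqr_ge0.
Qed.

Lemma Cauchy_Schwarz_dotp u v : `|dotp u v| <= enorm u * enorm v.
Proof.
have [->|v0] := eqVneq v 0; first by rewrite dotp0r normr0 enorm0 mulr0.
have vpos : 0 < enorm v.
  by rewrite lt_def enorm_ge0 andbT; apply: contra_neq v0; exact: enorm_eq0.
(* The squared norm of this vector is |v|^2 (|u|^2 |v|^2 - <u,v>^2). *)
have := dotp_ge0 (enorm v ^+ 2 *: u - dotp u v *: v).
rewrite !(dotpBl, dotpBr, dotpZl, dotpZr) -!sqr_enorm (dotpC v u) => h.
have {}h : 0 <= enorm v ^+ 2 * ((enorm u * enorm v) ^+ 2 - dotp u v ^+ 2).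
  by apply: le_trans h _; rewrite le_eqVlt; apply/orP; left; apply/eqP; ring.
move: h; rewrite pmulr_rge0 ?exprn_gt0// subr_ge0 => h.
by rewrite -[leRHS]ger0_norm ?mulr_ge0 ?enorm_ge0// -!sqrtr_sqr ler_wsqrtr.
Qed.

End dotp_theory.

Lemma dotpS (R : realType) (d : nat) (u v : 'rV[R]_d.+1) :
  dotp u v = u ord0 ord0 * v ord0 ord0 + dotp (rV_uncons u).2 (rV_uncons v).2.
Proof.
by rewrite /dotp big_ord_recl; congr (_ + _); apply: eq_bigr => i _; rewrite !mxE.
Qed.

Lemma measurable_dotp d (T : measurableType d) (R : realType) (n : nat)
    (f g : T -> 'rV[R]_n) :
  measurable_fun setT f -> measurable_fun setT g ->
  measurable_fun setT (fun x => dotp (f x) (g x)).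
Proof.
move=> mf mg; apply: measurable_sum => i; apply: measurable_funM.
  exact: (measurableT_comp (@measurable_coord R n i) mf).
exact: (measurableT_comp (@measurable_coord R n i) mg).
Qed.

Section integral_lebesgue_rV.
Context (R : realType).
Notation leb := (@lebesgue_measure R).

Lemma Rintegral_lebesgue_rVS (n : nat) (h : 'rV[R]_n.+1 -> R) :
  measurable_fun setT h ->
  (leb \x lebesgue_rV R n)%E.-integrable setT (EFin \o (h \o @rV_cons R n)) ->
  (lebesgue_rV R n.+1).-integrable setT (EFin \o h) /\
  \int[lebesgue_rV R n.+1]_v h v =
  \int[(leb \x lebesgue_rV R n)%E]_z h (rV_cons z).
Proof.
move=> mh ih.
(* [lebesgue_measure] lives on [measurableTypeR R], whose display is not that of [R]. *)
have mc : measurable_fun [set: (measurableTypeR R * 'rV[R]_n)%type] (@rV_cons R n).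
  exact: measurable_rV_cons.
split.
  exact: (integrable_pushforward mc (proj2 (measurable_EFinP _ _) mh) ih measurableT).
congr fine.
exact: (integral_pushforward mc (proj2 (measurable_EFinP _ _) mh) ih measurableT).
Qed.

Lemma Rintegral_rV0 (h : 'rV[R]_0 -> R) : measurable_fun setT h ->
  (lebesgue_rV R 0).-integrable setT (EFin \o h) /\
  \int[lebesgue_rV R 0]_v h v = h 0.
Proof.
move=> mh; split.
  apply/integrableP; split; first exact/measurable_EFinP.
  rewrite integral_dirac// ?diracT ?mul1e ?ltry//.
  by apply: measurableT_comp => //; exact/measurable_EFinP.
rewrite /Rintegral integral_dirac// ?diracT ?mul1e//.
exact/measurable_EFinP.
Qed.

(** The explicit functions on R^n used below (Gaussians, box indicators, tents) are products over
    the coordinates. Integrability and value go together because the induction on the dimension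
    needs both. *)
Lemma Rintegral_lebesgue_rV_prod (n : nat) (F : 'I_n -> R -> R) :
  (forall i, leb.-integrable setT (EFin \o F i)) ->
  (lebesgue_rV R n).-integrable setT
    (EFin \o (fun v : 'rV[R]_n => \prod_(i < n) F i (v ord0 i))) /\
  \int[lebesgue_rV R n]_v (\prod_(i < n) F i (v ord0 i)) =
  \prod_(i < n) \int[leb]_x F i x.
Proof.
elim: n F => [|n IH] F iF.
  have [] := @Rintegral_rV0 (fun v : 'rV[R]_0 => \prod_(i < 0) F i (v ord0 i)).
    by apply: measurable_prod => -[].
  by move=> i0 ->; split => //; rewrite !big_ord0.
have mF i : measurable_fun setT (F i) by exact: integrable_measurable_real (iF i).
have [iG GE] := IH (fun i => F (lift ord0 i)) (fun i => iF (lift ord0 i)).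
have [iFG FGE] := Rintegral_prod (iF ord0) iG.
have consE (z : R * 'rV[R]_n) : F ord0 z.1 * \prod_(i < n) F (lift ord0 i) (z.2 ord0 i) =
    \prod_(i < n.+1) F i (rV_cons z ord0 i).
  rewrite big_ord_recl; congr (F _ _ * _).
    by rewrite -[in LHS](rV_consK z).
  by apply: eq_bigr => i _; rewrite -[in LHS](rV_consK z) [in LHS]mxE.
have [||i1 ->] := @Rintegral_lebesgue_rVS n
    (fun v : 'rV[R]_n.+1 => \prod_(i < n.+1) F i (v ord0 i)).
- by apply: measurable_prod => i _; apply: (measurableT_comp (mF i)); exact: measurable_coord.
- by apply: eq_integrable iFG => // z _ /=; rewrite consE.
split=> //; rewrite big_ord_recl -GE -FGE.
by apply: eq_Rintegral => z _; rewrite consE.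
Qed.

End integral_lebesgue_rV.

(** * The normal density and its Fourier transform *)

Lemma cos_abs_le1 (R : realType) (x : R) : `|cos x| <= 1.
Proof. by rewrite ler_norml cos_geN1 cos_le1. Qed.

Lemma sin_abs_le1 (R : realType) (x : R) : `|sin x| <= 1.
Proof. by rewrite ler_norml sin_geN1 sin_le1. Qed.

Lemma measurable_cos (R : realType) : measurable_fun setT (@cos R).
Proof. by apply: continuous_measurable_fun; exact: continuous_cos. Qed.

Lemma measurable_sin (R : realType) : measurable_fun setT (@sin R).
Proof. by apply: continuous_measurable_fun; exact: continuous_sin. Qed.

Section derivatives.
Context (R : realType).
Implicit Types x y a c : R.

Lemma is_derive_scale x y : is_derive x 1 (fun t : R => t * y) y.
Proof.
rewrite (_ : (fun t : R => t * y) = (id : R -> R) * cst y); last by apply/funext.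
by apply: is_derive_eq; rewrite scaler0 add0r /= /GRing.scale /= mulr1.
Qed.

Lemma is_derive_affine x y a : is_derive x 1 (fun t : R => t * y + a) y.
Proof.
have := is_derive_scale x y => d.
rewrite (_ : (fun t : R => _) = (fun t : R => t * y) + cst a); last by apply/funext.
by apply: is_derive_eq; rewrite addr0.
Qed.

Lemma is_derive_sin_affine x y a :
  is_derive x 1 (fun t : R => sin (t * y + a)) (y * cos (x * y + a)).
Proof.
rewrite mulrC.
apply: (@is_derive1_comp _ sin (fun t => t * y + a) x _ _ (is_derive_sin _)).
exact: is_derive_affine.
Qed.

Lemma is_derive_cos_affine x y a :
  is_derive x 1 (fun t : R => cos (t * y + a)) (- (y * sin (x * y + a))).
Proof.
rewrite mulrC -mulNr.
apply: (@is_derive1_comp _ cos (fun t => t * y + a) x _ _ (is_derive_cos _)).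
exact: is_derive_affine.
Qed.

Lemma is_derive_gauss x c :
  is_derive x 1 (fun t : R => expR (- (c * t ^+ 2))) (- (c * x *+ 2) * expR (- (c * x ^+ 2))).
Proof.
rewrite mulrC.
apply: (@is_derive1_comp _ expR (fun t => - (c * t ^+ 2)) x _ _ (is_derive_expR _)).
rewrite (_ : (fun t : R => _) = (cst (- c)) * ((id : R -> R) ^+ 2)); last first.
  by apply/funext => t; rewrite /= mulNr.
apply: is_derive_eq.
rewrite /= /GRing.scale /=. ring.
Qed.

End derivatives.

Section normal_pdf_facts.
Context (R : realType).
Implicit Types m s t x y : R.

(** A factor |t - m| is absorbed by widening the Gaussian from s to sqrt 2 s. This gives
    integrability, decay at infinity and an approximation rate without computing a first absolute
    moment. *)
Lemma abs_center_normal_pdf_le m s t : 0 < s ->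
  `|t - m| * normal_pdf m s t <= Num.sqrt 2 * s * normal_pdf m (Num.sqrt 2 * s) t.
Proof.
move=> s0; have sq2 : 0 < Num.sqrt 2 :> R by rewrite sqrtr_gt0.
have s20 : 0 < Num.sqrt 2 * s by rewrite mulr_gt0.
rewrite !normal_pdfE ?gt_eqF// /normal_peak /normal_fun.
have -> : Num.sqrt ((Num.sqrt 2 * s) ^+ 2 * pi *+ 2) =
    Num.sqrt 2 * Num.sqrt (s ^+ 2 * pi *+ 2) :> R.
  rewrite -sqrtrM//; congr Num.sqrt.
  by rewrite exprMn sqr_sqrtr//; ring.
rewrite invfM; set p := (Num.sqrt (_ *+ 2))^-1.
have p0 : 0 <= p by rewrite invr_ge0 sqrtr_ge0.
rewrite [leRHS](_ : _ = p * (s * expR (- (t - m) ^+ 2 / ((Num.sqrt 2 * s) ^+ 2 *+ 2)))); last first.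
  by field; rewrite gt_eqF.
rewrite mulrCA ler_wpM2l//; set u := `|t - m| / s.
have -> : `|t - m| = s * u by rewrite mulrC divfK// gt_eqF.
have uE : (t - m) ^+ 2 = s ^+ 2 * u ^+ 2.
  by rewrite -exprMn mulrC divfK ?gt_eqF// real_normK// num_real.
have -> : - (t - m) ^+ 2 / (s ^+ 2 *+ 2) = - (u ^+ 2 / 2).
  by rewrite uE; field; rewrite gt_eqF.
have -> : - (t - m) ^+ 2 / ((Num.sqrt 2 * s) ^+ 2 *+ 2) = - (u ^+ 2 / 2) + u ^+ 2 / 4.
  by rewrite uE (exprMn 2 (Num.sqrt 2) s) sqr_sqrtr//; field; rewrite gt_eqF.
(* [u <= 1 + u^2 / 4 <= exp (u^2 / 4)] *)
rewrite -mulrA ler_pM2l// expRD mulrC ler_wpM2l ?expR_ge0//.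
apply: le_trans (expR_ge1Dx _); rewrite -subr_ge0.
have -> : 1 + u ^+ 2 / 4 - u = (u / 2 - 1) ^+ 2 by field.
exact: sqr_ge0.
Qed.

Lemma normal_pdf0E s t : s != 0 ->
  normal_pdf 0 s t = normal_peak s * expR (- ((s ^+ 2 *+ 2)^-1 * t ^+ 2)).
Proof.
move=> s0; rewrite normal_pdfE// /normal_fun subr0; congr (_ * expR _).
by rewrite mulNr mulrC.
Qed.

Lemma is_derive_normal_pdf s t : s != 0 ->
  is_derive t 1 (normal_pdf 0 s) (- (t / s ^+ 2) * normal_pdf 0 s t).
Proof.
move=> s0; rewrite normal_pdf0E//.
rewrite (_ : normal_pdf 0 s =
    cst (normal_peak s) * (fun t => expR (- ((s ^+ 2 *+ 2)^-1 * t ^+ 2)))); last first.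
  by apply/funext => x; rewrite normal_pdf0E.
have := is_derive_gauss t (s ^+ 2 *+ 2)^-1 => dg.
apply: is_derive_eq; rewrite scaler0 addr0 /= /GRing.scale /=.
by field.
Qed.

Lemma integrable_abs_normal_pdf s : 0 < s ->
  (@lebesgue_measure R).-integrable setT (EFin \o (fun t => `|t| * normal_pdf 0 s t)).
Proof.
move=> s0; apply: (@le_Rintegrable _ (measurableTypeR R) _ _ _
    (fun t : R => Num.sqrt 2 * s * normal_pdf 0 (Num.sqrt 2 * s) t)).
- by apply: measurable_funM; [exact: normr_measurable|exact: measurable_normal_pdf].
- move=> t; rewrite ger0_norm ?mulr_ge0 ?normal_pdf_ge0//.
  by have := abs_center_normal_pdf_le 0 t s0; rewrite subr0.
- have := integrableZl measurableT (Num.sqrt 2 * s) (integrable_normal_pdf 0 (Num.sqrt 2 * s)).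
  by apply: eq_integrable.
Qed.

Lemma Rintegral_normal_pdf m s : \int[@lebesgue_measure R]_t normal_pdf m s t = 1.
Proof. by rewrite /Rintegral integral_normal_pdf. Qed.

Lemma integrable_normal_pdf_mul m s (g : R -> R) (M : R) :
  measurable_fun setT g -> (forall x, `|g x| <= M) ->
  (@lebesgue_measure R).-integrable setT (EFin \o (fun t => g t * normal_pdf m s t)).
Proof.
move=> mg gM; apply: (@le_Rintegrable _ (measurableTypeR R) _ _ _ (fun t => M * normal_pdf m s t)).
- by apply: measurable_funM => //; exact: measurable_normal_pdf.
- by move=> t; rewrite normrM ler_pM// ger0_norm// normal_pdf_ge0.
- have := integrableZl measurableT M (integrable_normal_pdf m s).
  by apply: eq_integrable.
Qed.

(** Integrate L |t - m| against the density and absorb the factor |t - m| into the wider Gaussian,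
    whose mass is 1. *)
Lemma Rintegral_normal_pdf_approx m s (g : R -> R) (M L : R) : 0 < s ->
  measurable_fun setT g -> (forall x, `|g x| <= M) ->
  (forall x y, `|g x - g y| <= L * `|x - y|) ->
  `|\int[@lebesgue_measure R]_t (g t * normal_pdf m s t) - g m| <= L * (Num.sqrt 2 * s).
Proof.
move=> s0 mg gM gL.
have L0 : 0 <= L by have := gL 1 0; rewrite subr0 normr1 mulr1; exact: le_trans.
have i1 := integrable_normal_pdf_mul m s mg gM.
have i2 : (@lebesgue_measure R).-integrable setT (EFin \o (fun t => g m * normal_pdf m s t)).
  by apply: (@integrable_normal_pdf_mul _ _ (cst (g m)) `|g m|).
have -> : g m = \int[@lebesgue_measure R]_t (g m * normal_pdf m s t).
  by rewrite RintegralZl//; [rewrite Rintegral_normal_pdf mulr1|exact: integrable_normal_pdf].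
rewrite -RintegralB//; apply: (le_trans (le_normr_Rintegral _ _)) => //.
  exact: integrableB i1 i2.
have i3 : (@lebesgue_measure R).-integrable setT
    (EFin \o (fun t => L * (Num.sqrt 2 * s) * normal_pdf m (Num.sqrt 2 * s) t)).
  by apply: (@integrable_normal_pdf_mul _ _ (cst (L * (Num.sqrt 2 * s))) `|L * (Num.sqrt 2 * s)|).
have -> : L * (Num.sqrt 2 * s) = \int[@lebesgue_measure R]_t
    (L * (Num.sqrt 2 * s) * normal_pdf m (Num.sqrt 2 * s) t).
  by rewrite RintegralZl//; [rewrite Rintegral_normal_pdf mulr1|exact: integrable_normal_pdf].
apply: le_Rintegral => //.
  exact: (integrable_norm (integrableB measurableT i1 i2)).
move=> t _; rewrite -mulrBl normrM [X in _ * X]ger0_norm ?normal_pdf_ge0// -mulrA.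
apply: (le_trans (ler_wpM2r (normal_pdf_ge0 _ _ _) (gL _ _))).
by rewrite -mulrA ler_wpM2l// abs_center_normal_pdf_le.
Qed.

End normal_pdf_facts.

Section normal_pdf_characteristic.
Context (R : realType) (s a : R).
Hypothesis s0 : 0 < s.
Notation leb := (@lebesgue_measure R).
Let N := normal_pdf 0 s.

Let s_neq0 : s != 0. Proof. by rewrite gt_eqF. Qed.

Lemma measurable_affine_comp (g : R -> R) (y : R) :
  measurable_fun setT g -> measurable_fun setT (fun t : R => g (t * y + a)).
Proof.
by move=> mg; apply: measurableT_comp => //; apply: measurable_funD => //; exact: measurable_funM.
Qed.

Let measurable_sinN (y : R) : measurable_fun setT (fun t : R => sin (t * y + a)).
Proof. by apply: measurable_affine_comp; exact: measurable_sin. Qed.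

Let measurable_cosN (y : R) : measurable_fun setT (fun t : R => cos (t * y + a)).
Proof. by apply: measurable_affine_comp; exact: measurable_cos. Qed.

Let h (y t : R) := y * cos (t * y + a) * N t - t * sin (t * y + a) / s ^+ 2 * N t.

Let is_derive_sinN (y t : R) : is_derive t 1 (fun t => sin (t * y + a) * N t) (h y t).
Proof.
have d1 := is_derive_sin_affine t y a; have d2 := is_derive_normal_pdf t s_neq0.
have := is_deriveM d1 d2; rewrite /GRing.scale /= => d.
apply: (is_derive_eq d); rewrite /h /N; by field.
Qed.

Let integrable_cosN (y : R) : leb.-integrable setT (EFin \o (fun t => y * cos (t * y + a) * N t)).
Proof.
apply: (@integrable_normal_pdf_mul _ _ _ (fun t => y * cos (t * y + a)) `|y|).
  by apply: measurable_funM => //; exact: measurable_cosN.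
by move=> x; rewrite normrM ler_piMr// cos_abs_le1.
Qed.

Let integrable_tsinN (y : R) : leb.-integrable setT (EFin \o (fun t => t * sin (t * y + a) * N t)).
Proof.
apply: (@le_Rintegrable _ (measurableTypeR R) _ _ _ (fun t : R => `|t| * N t)).
- apply: measurable_funM; last exact: measurable_normal_pdf.
  by apply: measurable_funM => //; exact: measurable_sinN.
- move=> t; rewrite !normrM (ger0_norm (normal_pdf_ge0 _ _ _)) ler_wpM2r ?normal_pdf_ge0//.
  by rewrite ler_piMr// sin_abs_le1.
- exact: integrable_abs_normal_pdf.
Qed.

Let integrable_tsinN_div (y : R) :
  leb.-integrable setT (EFin \o (fun t => t * sin (t * y + a) / s ^+ 2 * N t)).
Proof.
have := integrableZl measurableT (s ^- 2) (integrable_tsinN y).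
by apply: eq_integrable => // t _ /=; rewrite -EFinM; congr EFin; ring.
Qed.

Let integrable_h (y : R) : leb.-integrable setT (EFin \o h y).
Proof. exact: (integrableB measurableT (integrable_cosN y) (integrable_tsinN_div y)). Qed.

Let continuous_h (y : R) : continuous (h y).
Proof.
have c1 (g : R -> R) : continuous g -> continuous (fun t : R => g (t * y + a)).
  move=> cg t; apply: (@continuous_comp _ _ _ (fun t : R => t * y + a) g); last exact: cg.
  by apply: cvgD; [exact: mulrr_continuous|exact: cvg_cst].
have cN : continuous (N : R -> R) by exact: continuous_normal_pdf.
move=> t; apply: cvgB.
  apply: cvgM; last exact: cN.
  by apply: cvgM; [exact: cvg_cst|apply: c1 => ?; exact: continuous_cos].
apply: cvgM; last exact: cN.
apply: cvgM; last exact: cvg_cst.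
by apply: cvgM; [exact: cvg_id|apply: c1 => ?; exact: continuous_sin].
Qed.

(** The endpoint is [n.+1] so that the interval is nondegenerate, as the fundamental theorem of
    calculus requires. *)
Let integral_h_itv (y : R) (n : nat) :
  \int[leb]_t (h y \_ `[- n.+1%:R, n.+1%:R]) t =
  sin (n.+1%:R * y + a) * N n.+1%:R - sin (- n.+1%:R * y + a) * N (- n.+1%:R).
Proof.
pose H t := sin (t * y + a) * N t.
have cH : continuous H.
  move=> t; apply: differentiable_continuous; apply/derivable1_diffP.
  by have [] := is_derive_sinN y t.
rewrite -Rintegral_mkcond /Rintegral (@continuous_FTC2 _ _ H) //.
- by rewrite -subr_gt0 opprK addr_gt0.
- by apply: continuous_subspaceT; exact: continuous_h.
- split.
  + by move=> t _; have [] := is_derive_sinN y t.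
  + exact/cvg_at_right_filter/cH.
  + exact/cvg_at_left_filter/cH.
- by move=> t _; rewrite derive1E; have [_ ->] := is_derive_sinN y t.
Qed.

(* The integrand is the derivative of [sin (t * y + a) * N t], which vanishes at infinity. *)
Lemma Rintegral_normal_Stein (y : R) : \int[leb]_t h y t = 0.
Proof.
(* [K] bounds [|t| * N t], so each boundary term at distance n + 1 from 0 is at most K / (n + 1). *)
pose K := Num.sqrt 2 * s * normal_peak (Num.sqrt 2 * s).
have NK t : `|t| * N t <= K.
  have := abs_center_normal_pdf_le 0 t s0; rewrite subr0 => /le_trans; apply.
  apply: ler_wpM2l; first by rewrite mulr_ge0 ?sqrtr_ge0 ?ltW.
  by apply: normal_pdf_ub; rewrite mulf_neq0// gt_eqF// sqrtr_gt0.
have c1 : \int[leb]_t (h y \_ `[- n.+1%:R, n.+1%:R]) t @[n --> \oo] --> \int[leb]_t h y t.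
  apply: (@Rintegral_dominated_cvg _ (measurableTypeR R) _ leb _ _ (fun t => `|h y t|)).
  - move=> n; apply/measurable_restrict => //.
    rewrite setTI; apply: measurable_funTS; exact: integrable_measurable_real (integrable_h y).
  - move=> t; apply: (cvg_near_cst) .
    near=> n; rewrite patchE ifT// inE /= in_itv /= -ler_norml.
    near: n; exists (Num.Def.truncn `|t|) => // n /= tn.
    apply: ltW; rewrite (lt_le_trans (truncnS_gt _))// ler_nat ltnS//.
  - exact: (integrable_norm (integrable_h y)).
  - by move=> n t; rewrite patchE; case: ifP => // _; rewrite normr0.
have c2 : \int[leb]_t (h y \_ `[- n.+1%:R, n.+1%:R]) t @[n --> \oo] --> (0 : R).
  apply: norm_cvg0; apply: (@squeeze_cvgr _ _ _ _ (cst 0) (fun n => (K *+ 2) * n.+1%:R^-1)).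
  - near=> n; rewrite normr_ge0 /= integral_h_itv.
    apply: (le_trans (ler_normB _ _)).
    have b t : `|t| = n.+1%:R -> `|sin (t * y + a) * N t| <= K * n.+1%:R^-1.
      move=> tn; rewrite ler_pdivlMr// -tn normrM (ger0_norm (normal_pdf_ge0 _ _ _)) -mulrA.
      rewrite [X in _ * X]mulrC; apply: le_trans (NK t).
      by rewrite ler_piMl ?mulr_ge0 ?normal_pdf_ge0// sin_abs_le1.
    by rewrite mulr2n mulrDl lerD// b// ?normrN normr_nat.
  - exact: cvg_cst.
  - rewrite -[X in _ --> X](mulr0 (K *+ 2)); apply: cvgMr.
    exact: cvg_harmonic.
exact: (cvg_unique _ c1 c2).
Unshelve. all: by end_near. Qed.

(* Differentiating under the integral and Stein's identity give [F' y = - s^2 y F y]. The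
   phase [a] treats the cosine and the sine transform at once. *)
Lemma Rintegral_cos_phase_normal_pdf (y : R) :
  \int[leb]_t (cos (t * y + a) * normal_pdf 0 s t) =
  cos a * expR (- (s ^+ 2 / 2 * y ^+ 2)).
Proof.
pose F y := \int[leb]_t (cos (t * y + a) * N t).
have dcos (x t : R) :
    is_derive x 1 (fun y => cos (t * y + a) * N t) (- (t * sin (t * x + a) * N t)).
  have d1 : is_derive x 1 (fun y => cos (t * y + a)) (- (t * sin (t * x + a))).
    have := is_derive_cos_affine x t a; rewrite [x * t]mulrC.
    by rewrite (_ : (fun t0 => cos (t0 * t + a)) = (fun y => cos (t * y + a)))//;
      apply/funext => z; rewrite mulrC.
  have := is_deriveM d1 (is_derive_cst (N t) x 1).
  by rewrite /GRing.scale /= mulr0 add0r => /is_derive_eq; apply; ring.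
have dF (x : R) : is_derive x 1 F (- (s ^+ 2 * x) * F x).
  have Ix : `]x - 1, x + 1[%classic x.
    by rewrite /= in_itv /= ltrDl ltr01 ltrBlDr ltrDl ltr01.
  have A1 (z : R) : `]x - 1, x + 1[%classic z ->
      leb.-integrable setT (EFin \o (fun t => cos (t * z + a) * N t)).
    move=> _; apply: (@integrable_normal_pdf_mul _ _ _ (fun t => cos (t * z + a)) 1).
      exact: measurable_cosN.
    by move=> t; exact: cos_abs_le1.
  have A2 (z t : R) : `]x - 1, x + 1[%classic z -> (setT : set (measurableTypeR R)) t ->
      derivable (fun y => cos (t * y + a) * N t) z 1.
    by move=> _ _; have [] := dcos z t.
  have A3 (z t : R) : `]x - 1, x + 1[%classic z -> (setT : set (measurableTypeR R)) t ->
      `|partial1of2 (fun z t => cos (t * z + a) * N t) z t| <= `|t| * N t.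
    move=> _ _; rewrite partial1of2E; have [_ ->] := dcos z t.
    rewrite normrN !normrM (ger0_norm (normal_pdf_ge0 _ _ _)) ler_wpM2r ?normal_pdf_ge0//.
    by rewrite ler_piMr// sin_abs_le1.
  have G0 (t : measurableTypeR R) : 0 <= `|t : R| * N t by rewrite mulr_ge0// normal_pdf_ge0.
  have iG := integrable_abs_normal_pdf s0.
  have der := derivable_under_integral measurableT Ix A1 A2 G0 iG A3.
  have val := differentiation_under_integral measurableT Ix A1 A2 G0 iG A3.
  apply: DeriveDef => //.
  rewrite -derive1E val.
  have st := Rintegral_normal_Stein x.
  rewrite /h RintegralB// in st.
  have E1 : \int[leb]_t (x * cos (t * x + a) * N t) = x * F x.
    by rewrite -RintegralZl//; [apply: eq_Rintegral => t _; rewrite mulrA|exact: (A1 x)].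
  have E2 : \int[leb]_t (t * sin (t * x + a) / s ^+ 2 * N t) =
      s ^- 2 * \int[leb]_t (t * sin (t * x + a) * N t).
    by rewrite -RintegralZl//; apply: eq_Rintegral => t _; ring.
  rewrite E1 E2 in st.
  transitivity (- \int[leb]_t (t * sin (t * x + a) * N t)).
    rewrite -mulN1r -RintegralZl//; apply: eq_Rintegral => t _.
    by rewrite partial1of2E; have [_ ->] := dcos x t; rewrite mulN1r.
  move/eqP : st; rewrite subr_eq0 => /eqP st.
  by rewrite mulNr -mulrA st mulrA divff ?mul1r// expf_neq0.
(* Integrating factor: [E] has zero derivative, hence equals its value cos a at 0. *)
pose E (x : R) := F x * expR (- (- (s ^+ 2 / 2) * x ^+ 2)).
have dE (x : R) : is_derive x 1 E 0.
  have := is_deriveM (dF x) (is_derive_gauss x (- (s ^+ 2 / 2))).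
  by rewrite /GRing.scale /= => /is_derive_eq; apply; field.
have := is_derive_0_is_cst y 0 dE.
have F0 : F 0 = cos a.
  rewrite /F -[RHS]mulr1 -(Rintegral_normal_pdf 0 s) -RintegralZl//.
    by apply: eq_Rintegral => t _; rewrite mulr0 add0r.
  exact: integrable_normal_pdf.
rewrite /E F0 expr0n /= mulr0 oppr0 expR0 mulr1 mulNr opprK -/(F y) => Ey.
by rewrite expRN -Ey mulfK// gt_eqF// expR_gt0.
Qed.

End normal_pdf_characteristic.

Lemma Rintegral_cos_normal_pdf (R : realType) (s y : R) : 0 < s ->
  \int[@lebesgue_measure R]_t (cos (t * y) * normal_pdf 0 s t) =
  expR (- (s ^+ 2 / 2 * y ^+ 2)).
Proof.
move=> s0; rewrite -[RHS]mul1r -[X in X * _]cos0. rewrite -(Rintegral_cos_phase_normal_pdf 0 s0).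
by apply: eq_Rintegral => t _; rewrite addr0.
Qed.

Lemma Rintegral_sin_normal_pdf (R : realType) (s y : R) : 0 < s ->
  \int[@lebesgue_measure R]_t (sin (t * y) * normal_pdf 0 s t) = 0.
Proof.
(* The phase -pi/2 turns the cosine into the sine. *)
move=> s0; transitivity (cos (- (pi / 2)) * expR (- (s ^+ 2 / 2 * y ^+ 2))).
  rewrite -(Rintegral_cos_phase_normal_pdf _ s0).
  apply: eq_Rintegral => t _; congr (_ * _).
  by rewrite cosBpihalf.
by rewrite cosN cos_pihalf mul0r.
Qed.

Lemma dotp_cons (R : realType) (n : nat) (z : R * 'rV[R]_n) (y : 'rV[R]_n.+1) :
  dotp (rV_cons z) y = z.1 * y ord0 ord0 + dotp z.2 (rV_uncons y).2.
Proof.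
rewrite dotpS -[in RHS](rV_consK z); congr (_ * _ + _).
Qed.

(** The product form integrates coordinate by coordinate; [gauss_rVE] recovers the exponential of
    the squared Euclidean norm. *)
Definition gauss_rV (R : realType) (n : nat) (s : R) (x : 'rV[R]_n) : R :=
  \prod_(i < n) normal_pdf 0 s (x ord0 i).

Section gauss_rV_theory.
Context (R : realType).
Implicit Types s c : R.

Lemma gauss_rV_cons (n : nat) s (z : R * 'rV[R]_n) :
  gauss_rV s (rV_cons z) = normal_pdf 0 s z.1 * gauss_rV s z.2.
Proof.
rewrite /gauss_rV big_ord_recl; congr (normal_pdf _ _ _ * _).
  by rewrite -[in RHS](rV_consK z).
by apply: eq_bigr => i _; rewrite -[in RHS](rV_consK z) [in RHS]mxE.
Qed.

Lemma gauss_rV_ge0 (n : nat) s (x : 'rV[R]_n) : 0 <= gauss_rV s x.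
Proof. by apply: prodr_ge0 => i _; exact: normal_pdf_ge0. Qed.

Lemma integrable_gauss_rV (n : nat) s :
  (lebesgue_rV R n).-integrable setT (EFin \o @gauss_rV R n s).
Proof.
exact: (Rintegral_lebesgue_rV_prod (fun=> integrable_normal_pdf 0 s)).1.
Qed.

Lemma integrable_gauss_rV_mul (n : nat) s (g : 'rV[R]_n -> R) (M : R) :
  measurable_fun setT g -> (forall x, `|g x| <= M) ->
  (lebesgue_rV R n).-integrable setT (EFin \o (fun x => g x * gauss_rV s x)).
Proof.
move=> mg gM; have ig := integrable_gauss_rV n s.
apply: (@le_Rintegrable _ _ _ _ _ (fun x => M * gauss_rV s x)).
- by apply: measurable_funM => //; exact: integrable_measurable_real ig.
- by move=> x; rewrite normrM (ger0_norm (gauss_rV_ge0 _ _)) ler_wpM2r ?gauss_rV_ge0.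
- have := integrableZl measurableT M ig.
  by apply: eq_integrable.
Qed.

Lemma measurable_cos_dotp (n : nat) (y : 'rV[R]_n) :
  measurable_fun setT (fun t : 'rV[R]_n => cos (dotp t y)).
Proof.
apply: measurableT_comp; first exact: measurable_cos.
by apply: measurable_dotp; [exact: measurable_id|exact: measurable_cst].
Qed.

Lemma measurable_sin_dotp (n : nat) (y : 'rV[R]_n) :
  measurable_fun setT (fun t : 'rV[R]_n => sin (dotp t y)).
Proof.
apply: measurableT_comp; first exact: measurable_sin.
by apply: measurable_dotp; [exact: measurable_id|exact: measurable_cst].
Qed.

(** The addition formulas mix cosine and sine when a coordinate is split off, so the induction must
    carry both transforms. *)
Lemma Rintegral_cos_sin_gauss_rV (n : nat) s (y : 'rV[R]_n) : 0 < s ->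
  \int[lebesgue_rV R n]_t (cos (dotp t y) * gauss_rV s t) =
    expR (- (s ^+ 2 / 2 * dotp y y)) /\
  \int[lebesgue_rV R n]_t (sin (dotp t y) * gauss_rV s t) = 0.
Proof.
move=> s0; elim: n y => [|n IH] y.
  have mg := integrable_measurable_real (integrable_gauss_rV 0 s).
  split; rewrite (Rintegral_rV0 _).2; last 2 first.
  - by rewrite /gauss_rV big_ord0 mulr1 dotp0l sin0.
  - by apply: measurable_funM => //; exact: measurable_sin_dotp.
  - by rewrite /gauss_rV big_ord0 mulr1 /dotp !big_ord0 mulr0 oppr0 expR0 cos0.
  - by apply: measurable_funM => //; exact: measurable_cos_dotp.
set y' := (rV_uncons y).2; set y0 := y ord0 ord0.
have [IHc IHs] := IH y'.
have ic : (@lebesgue_measure R).-integrable setT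
    (EFin \o (fun t => cos (t * y0) * normal_pdf 0 s t)).
  apply: (@integrable_normal_pdf_mul _ _ _ (fun t => cos (t * y0)) 1).
    have := measurable_affine_comp 0 y0 (@measurable_cos R).
    by under eq_fun do rewrite addr0.
  by move=> t; exact: cos_abs_le1.
have isn : (@lebesgue_measure R).-integrable setT
    (EFin \o (fun t => sin (t * y0) * normal_pdf 0 s t)).
  apply: (@integrable_normal_pdf_mul _ _ _ (fun t => sin (t * y0)) 1).
    have := measurable_affine_comp 0 y0 (@measurable_sin R).
    by under eq_fun do rewrite addr0.
  by move=> t; exact: sin_abs_le1.
have jc := @integrable_gauss_rV_mul n s _ 1 (measurable_cos_dotp y')
  (fun=> cos_abs_le1 _).
have js := @integrable_gauss_rV_mul n s _ 1 (measurable_sin_dotp y')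
  (fun=> sin_abs_le1 _).
have [i1 E1] := Rintegral_prod ic jc.
have [i2 E2] := Rintegral_prod isn js.
have [i3 E3] := Rintegral_prod isn jc.
have [i4 E4] := Rintegral_prod ic js.
have mg := integrable_measurable_real (integrable_gauss_rV n.+1 s).
have eqc (z : R * 'rV[R]_n) : cos (dotp (rV_cons z) y) * gauss_rV s (rV_cons z) =
    cos (z.1 * y0) * normal_pdf 0 s z.1 * (cos (dotp z.2 y') * gauss_rV s z.2)
    - sin (z.1 * y0) * normal_pdf 0 s z.1 * (sin (dotp z.2 y') * gauss_rV s z.2).
  by rewrite dotp_cons gauss_rV_cons cosD -/y0 -/y'; ring.
have eqs (z : R * 'rV[R]_n) : sin (dotp (rV_cons z) y) * gauss_rV s (rV_cons z) =
    sin (z.1 * y0) * normal_pdf 0 s z.1 * (cos (dotp z.2 y') * gauss_rV s z.2)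
    + cos (z.1 * y0) * normal_pdf 0 s z.1 * (sin (dotp z.2 y') * gauss_rV s z.2).
  by rewrite dotp_cons gauss_rV_cons sinD -/y0 -/y'; ring.
split.
- rewrite (Rintegral_lebesgue_rVS (h := fun t => cos (dotp t y) * gauss_rV s t) _ _).2.
  + under eq_Rintegral do rewrite eqc.
    rewrite RintegralB// E1 E2 IHc IHs mulr0 subr0.
    by rewrite Rintegral_cos_normal_pdf// -expRD dotpS -/y' -/y0; congr expR; ring.
  + by apply: measurable_funM => //; exact: measurable_cos_dotp.
  + apply: eq_integrable (integrableB measurableT i1 i2) => // z _ /=.
    by rewrite eqc EFinB.
- rewrite (Rintegral_lebesgue_rVS (h := fun t => sin (dotp t y) * gauss_rV s t) _ _).2.
  + under eq_Rintegral do rewrite eqs.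
    rewrite RintegralD// E3 E4 IHc IHs mulr0 addr0.
    by rewrite Rintegral_sin_normal_pdf// mul0r.
  + by apply: measurable_funM => //; exact: measurable_sin_dotp.
  + apply: eq_integrable (integrableD measurableT i3 i4) => // z _ /=.
    by rewrite eqs EFinD.
Qed.

Lemma gauss_rVE (n : nat) s (t : 'rV[R]_n) : s != 0 ->
  gauss_rV s t = normal_peak s ^+ n * expR (- ((s ^+ 2 *+ 2)^-1 * dotp t t)).
Proof.
move=> s0; rewrite /gauss_rV; under eq_bigr do rewrite normal_pdf0E//.
rewrite big_split /= prodr_const card_ord -expR_sum; congr (_ * expR _).
by rewrite /dotp mulr_sumr -sumrN; apply: eq_bigr => i _; rewrite expr2.
Qed.

(** The origin of the factor (2 pi)^-n in the inversion formula: one factor 1/(2 pi) per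
    coordinate. *)
Lemma normal_peakV s : 0 < s -> normal_peak s * normal_peak s^-1 = (2 * pi)^-1.
Proof.
move=> s0; rewrite /normal_peak -invfM -sqrtrM; last first.
  by rewrite mulrn_wge0// mulr_ge0 ?pi_ge0 ?sqr_ge0.
have -> : s ^+ 2 * pi *+ 2 * (s^-1 ^+ 2 * pi *+ 2) = (2 * pi) ^+ 2.
  by field; rewrite gt_eqF.
rewrite sqrtr_sqr ger0_norm; first by [].
by rewrite mulr_ge0 ?pi_ge0.
Qed.

Lemma expR_gauss_rV (n : nat) s (t : 'rV[R]_n) : 0 < s ->
  expR (- (s ^+ 2 / 2 * dotp t t)) = (normal_peak s^-1)^-1 ^+ n * gauss_rV s^-1 t.
Proof.
move=> s0; have sV0 : s^-1 != 0 by rewrite gt_eqF// invr_gt0.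
rewrite gauss_rVE// mulrA -exprMn mulVf ?gt_eqF ?normal_peak_gt0//.
by rewrite expr1n mul1r; congr expR; field; rewrite gt_eqF.
Qed.

Lemma integrable_expR_dotp (n : nat) c : 0 < c ->
  (lebesgue_rV R n).-integrable setT (EFin \o (fun t : 'rV[R]_n => expR (- (c * dotp t t)))).
Proof.
(* The width is chosen so that s^2/2 = c, which makes the integrand a multiple of a Gaussian
   density. *)
move=> c0; have s0 : 0 < Num.sqrt (2 * c) by rewrite sqrtr_gt0 mulr_gt0.
have cE : Num.sqrt (2 * c) ^+ 2 / 2 = c by rewrite sqr_sqrtr ?mulr_ge0 ?ltW//; field.
have E (t : 'rV[R]_n) := expR_gauss_rV t s0.
have := integrableZl measurableT ((normal_peak (Num.sqrt (2 * c))^-1)^-1 ^+ n)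
  (integrable_gauss_rV n (Num.sqrt (2 * c))^-1).
apply: eq_integrable => // t _; move: (E t); rewrite cE => Et.
by rewrite /comp Et.
Qed.

(** The transform of the Gaussian of width [s^-1] is a multiple of the one of width [s];
    [normal_peakV] evaluates the constant. *)
Lemma gauss_rV_inversion (n : nat) s (y : 'rV[R]_n) : 0 < s ->
  gauss_rV s y = (2 * pi) ^- n *
    \int[lebesgue_rV R n]_t (cos (dotp t y) * expR (- (s ^+ 2 / 2 * dotp t t))).
Proof.
move=> s0; have sV0 : 0 < s^-1 by rewrite invr_gt0.
have pV0 : normal_peak s^-1 != 0 by rewrite gt_eqF// normal_peak_gt0// gt_eqF.
transitivity ((2 * pi) ^- n * ((normal_peak s^-1)^-1 ^+ n *
    \int[lebesgue_rV R n]_t (cos (dotp t y) * gauss_rV s^-1 t))); last first.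
  congr (_ * _); rewrite -RintegralZl//; last first.
    exact: (@integrable_gauss_rV_mul n _ _ 1 (measurable_cos_dotp y) (fun=> cos_abs_le1 _)).
  by apply: eq_Rintegral => t _; rewrite expR_gauss_rV// mulrCA.
rewrite (Rintegral_cos_sin_gauss_rV y sV0).1 gauss_rVE ?gt_eqF// mulrA -exprVn -exprMn.
rewrite -(normal_peakV s0) mulfK//; congr (_ * expR _).
by field; rewrite gt_eqF.
Qed.

Lemma std_normal_pdfE (n : nat) (x : 'rV[R]_n) : std_normal_pdf x = gauss_rV 1 x.
Proof.
rewrite gauss_rVE ?oner_neq0// /std_normal_pdf sqr_enorm; congr (_ * expR _); last first.
  by field.
rewrite /normal_peak expr1n mul1r exprVn powRN; congr (_^-1).
rewrite [n%:R / 2]mulrC powRrM powR12_sqrt ?mulr_ge0 ?pi_ge0// powR_mulrn ?sqrtr_ge0//.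
by rewrite mulr_natl.
Qed.

End gauss_rV_theory.

(** * Fourier inversion *)

Lemma cvg_prod_seq (R : realType) (I : Type) (r : seq I) (F : nat -> I -> R) (l : I -> R) :
  (forall i, F k i @[k --> \oo] --> l i) ->
  \prod_(i <- r) F k i @[k --> \oo] --> \prod_(i <- r) l i.
Proof.
move=> Fl; elim: r => [|i r IH].
  by rewrite big_nil; under eq_fun do rewrite big_nil; exact: cvg_cst.
by rewrite big_cons; under eq_fun do rewrite big_cons; exact: cvgM.
Qed.

Lemma cos_Lipschitz (R : realType) (x y : R) : `|cos x - cos y| <= `|x - y|.
Proof.
wlog yx : x y / y <= x.
  move=> H; have [yx|/ltW xy] := leP y x; first exact: H.
  by rewrite distrC [leRHS]distrC; exact: H.
have [|c _ ->] := @MVT_segment R cos (fun z => - sin z) y x yx.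
  by apply: continuous_subspaceT; exact: continuous_cos.
by rewrite normrM normrN ler_piMl// sin_abs_le1.
Qed.

Lemma sin_Lipschitz (R : realType) (x y : R) : `|sin x - sin y| <= `|x - y|.
Proof. by rewrite -!cosBpihalf (le_trans (cos_Lipschitz _ _))// opprB addrA subrK. Qed.

Lemma enorm_le_sum (R : realType) (n : nat) (x : 'rV[R]_n) :
  enorm x <= \sum_(i < n) `|x ord0 i|.
Proof.
have s0 : 0 <= \sum_(i < n) `|x ord0 i| by exact: sumr_ge0.
rewrite -[leRHS]ger0_norm// -sqrtr_sqr ler_wsqrtr// expr2 mulr_sumr; apply: ler_sum => i _.
rewrite -expr2 -real_normK ?num_real// expr2.
by rewrite ler_wpM2r// (bigD1 i)//= lerDl sumr_ge0.
Qed.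

Lemma enorm_le_norm (R : realType) (n : nat) (x : 'rV[R]_n) : enorm x <= n%:R * `|x|.
Proof.
apply: (le_trans (enorm_le_sum x)).
rewrite (_ : n%:R * `|x| = \sum_(i < n) `|x|).
  by apply: ler_sum => i _; rewrite /Num.norm /= mx_normrE (le_bigmax _ _ (ord0, i)).
by rewrite sumr_const card_ord mulr_natl.
Qed.

(** Row vectors carry the topology of the max norm, so a Euclidean Lipschitz bound is transferred at
    the cost of a factor n. The summand 1 in [c] keeps it positive for the division. *)
Lemma Lipschitz_enorm_continuous (R : realType) (n : nat) (f : 'rV[R]_n -> R) (K : R) :
  (forall x y, `|f x - f y| <= K * enorm (x - y)) -> continuous f.
Proof.
move=> fK x.
apply/(@cvgrPdist_lt _ _ _ (nbhs x) (nbhs_filter x) f (f x)) => e e0.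
pose c := `|K| * n%:R + 1; have c0 : 0 < c by rewrite ltr_wpDl.
near=> y; apply: (le_lt_trans (fK x y)); apply: (@le_lt_trans _ _ (c * `|x - y|)).
  apply: (@le_trans _ _ (`|K| * enorm (x - y))).
    by rewrite ler_wpM2r ?enorm_ge0// ler_norm.
  apply: (@le_trans _ _ (`|K| * (n%:R * `|x - y|))); first by rewrite ler_wpM2l// enorm_le_norm.
  by rewrite mulrA ler_wpM2r// lerDl.
rewrite mulrC -ltr_pdivlMr//.
near: y; exact: (nbhs_ball_norm x (PosNum (divr_gt0 e0 c0))).
Unshelve. all: by end_near. Qed.

Definition re_cf d (T : measurableType d) (R : realType) (P : probability T R) (n : nat)
  (Z : T -> 'rV[R]_n) (t : 'rV[R]_n) : R := \int[P]_w cos (dotp t (Z w)).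

Definition im_cf d (T : measurableType d) (R : realType) (P : probability T R) (n : nat)
  (Z : T -> 'rV[R]_n) (t : 'rV[R]_n) : R := \int[P]_w sin (dotp t (Z w)).

Section inversion.
Context d (T : measurableType d) (R : realType) (P : probability T R) (n : nat).
Variable Z : T -> 'rV[R]_n.
Hypothesis mZ : measurable_fun setT Z.
Notation leb := (@lebesgue_measure R).
Notation lebn := (lebesgue_rV R n).

Let C := re_cf P Z.
Let S := im_cf P Z.

Lemma measurable_dotp_RV (t : 'rV[R]_n) : measurable_fun setT (fun w => dotp t (Z w)).
Proof. by apply: measurable_dotp => //; exact: measurable_cst. Qed.

Lemma measurable_cos_dotp_RV (t : 'rV[R]_n) : measurable_fun setT (fun w => cos (dotp t (Z w))).
Proof. by apply: measurableT_comp (measurable_dotp_RV t); exact: measurable_cos. Qed.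

Lemma measurable_sin_dotp_RV (t : 'rV[R]_n) : measurable_fun setT (fun w => sin (dotp t (Z w))).
Proof. by apply: measurableT_comp (measurable_dotp_RV t); exact: measurable_sin. Qed.

Lemma integrable_cos_dotp_RV (t : 'rV[R]_n) :
  P.-integrable setT (EFin \o (fun w => cos (dotp t (Z w)))).
Proof. by apply: integrable_bounded (measurable_cos_dotp_RV t) _ => w; exact: cos_abs_le1. Qed.

Lemma integrable_sin_dotp_RV (t : 'rV[R]_n) :
  P.-integrable setT (EFin \o (fun w => sin (dotp t (Z w)))).
Proof. by apply: integrable_bounded (measurable_sin_dotp_RV t) _ => w; exact: sin_abs_le1. Qed.

Lemma measurable_dotp_pair : measurable_fun setT (fun z : 'rV[R]_n * T => dotp z.1 (Z z.2)).
Proof. by apply: measurable_dotp => //; exact: measurableT_comp. Qed.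

(* Shifting by the constant 1 makes the integrand nonnegative, so that Tonelli applies. *)
Lemma measurable_Rintegral_trig (g : R -> R) : measurable_fun setT g -> (forall x, `|g x| <= 1) ->
  measurable_fun setT (fun t : 'rV[R]_n => \int[P]_w g (dotp t (Z w))).
Proof.
move=> mg g1.
have mgt t : measurable_fun setT (fun w => g (dotp t (Z w))).
  exact: measurableT_comp (measurable_dotp_RV t).
have m1 : measurable_fun setT (fun z : 'rV[R]_n * T => 1 + g (dotp z.1 (Z z.2))).
  by apply: measurable_funD => //; apply: measurableT_comp => //; exact: measurable_dotp_pair.
have p1 (z : 'rV[R]_n * T) : 0 <= 1 + g (dotp z.1 (Z z.2)).
  by have := g1 (dotp z.1 (Z z.2)); rewrite ler_norml => /andP[]; lra.
have H := measurable_Rintegral_section P m1 p1.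
have := measurable_funB H (measurable_cst (1 : R)).
apply: eq_measurable_fun => t _ /=; rewrite RintegralD//.
- by rewrite Rintegral_probability_cst addrC addKr.
- by apply: (integrable_bounded P (M := 1)) => // w; rewrite normr1.
- by apply: (integrable_bounded P (mgt t)) => w; exact: g1.
Qed.

Lemma measurable_re_cf : measurable_fun setT C.
Proof. by apply: measurable_Rintegral_trig; [exact: measurable_cos|exact: cos_abs_le1]. Qed.

Lemma measurable_im_cf : measurable_fun setT S.
Proof. by apply: measurable_Rintegral_trig; [exact: measurable_sin|exact: sin_abs_le1]. Qed.

(** The real part of exp(-i<t,x>) times the characteristic function of [Z]. The imaginary part is
    odd in t, so it contributes nothing to the inversion integral. *)
Let k x t := cos (dotp t x) * C t + sin (dotp t x) * S t.

Let kE x t : k x t = \int[P]_w cos (dotp t (x - Z w)).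
Proof.
rewrite /k /C /S /re_cf /im_cf.
rewrite -RintegralZl//; last exact: integrable_cos_dotp_RV.
rewrite -RintegralZl//; last exact: integrable_sin_dotp_RV.
rewrite -RintegralD//.
- by apply: eq_Rintegral => w _; rewrite dotpBr cosB.
- have := integrableZl measurableT (cos (dotp t x)) (integrable_cos_dotp_RV t).
  by apply: eq_integrable.
- have := integrableZl measurableT (sin (dotp t x)) (integrable_sin_dotp_RV t).
  by apply: eq_integrable.
Qed.

Let measurable_shift x : measurable_fun setT (fun w => x - Z w).
Proof.
apply: measurable_fun_rV => i; rewrite (_ : (fun _ => _) = (fun w => x ord0 i - Z w ord0 i)).
  by apply: measurable_funB => //; exact: measurableT_comp (@measurable_coord R n i) mZ.
by apply/funext => w; rewrite !mxE.
Qed.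

Lemma Rintegral_abs_le1 (f : T -> R) : measurable_fun setT f -> (forall w, `|f w| <= 1) ->
  `|\int[P]_w f w| <= 1.
Proof.
move=> mf f1; have if_ := integrable_bounded P mf f1.
apply: (le_trans (le_normr_Rintegral measurableT if_)).
rewrite -[leRHS](Rintegral_probability_cst P 1); apply: le_Rintegral => //.
- exact: (integrable_norm if_).
- by apply: (integrable_bounded P (M := 1)) => // w; rewrite normr1.
Qed.

Let integrable_cos_shift x t : P.-integrable setT (EFin \o (fun w => cos (dotp t (x - Z w)))).
Proof.
apply: (integrable_bounded P (M := 1)) => [|w]; last exact: cos_abs_le1.
apply: measurableT_comp; first exact: measurable_cos.
by apply: measurable_dotp => //; exact: measurable_cst.
Qed.

Let k_le1 x t : `|k x t| <= 1.
Proof.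
rewrite kE; apply: Rintegral_abs_le1 => [|w]; last exact: cos_abs_le1.
apply: measurableT_comp; first exact: measurable_cos.
by apply: measurable_dotp => //; exact: measurable_cst.
Qed.

Let measurable_k x : measurable_fun setT (k x).
Proof.
apply: measurable_funD; apply: measurable_funM.
- exact: measurable_cos_dotp.
- exact: measurable_re_cf.
- exact: measurable_sin_dotp.
- exact: measurable_im_cf.
Qed.

(** The density of Z + sN in the smoothing argument. *)
Let q s x := \int[P]_w gauss_rV s (x - Z w).

Let q_ge0 s x : 0 <= q s x.
Proof. by apply: Rintegral_ge0 => w _; exact: gauss_rV_ge0. Qed.

Let measurable_gauss_pair s :
  measurable_fun setT (fun z : 'rV[R]_n * T => gauss_rV s (z.1 - Z z.2)).
Proof.
apply: measurable_prod => i _; apply: measurableT_comp; first exact: measurable_normal_pdf.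
rewrite (_ : (fun _ => _) = (fun z : 'rV[R]_n * T => z.1 ord0 i - Z z.2 ord0 i)).
  apply: measurable_funB.
    exact: (measurableT_comp (@measurable_coord R n i) measurable_fst).
  apply: (measurableT_comp (@measurable_coord R n i)).
  exact: measurableT_comp.
by apply/funext => z; rewrite !mxE.
Qed.

Let measurable_gauss_swap s :
  measurable_fun setT (fun z : T * 'rV[R]_n => gauss_rV s (z.2 - Z z.1)).
Proof.
exact: (measurableT_comp (measurable_gauss_pair s)
  (measurable_fun_pair measurable_snd measurable_fst)).
Qed.

Let measurable_q s : measurable_fun setT (q s).
Proof.
exact: (measurable_Rintegral_section P (measurable_gauss_pair s)
  (fun z => gauss_rV_ge0 s (z.1 - Z z.2))).
Qed.

Let q_fourier s x : 0 < s ->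
  q s x = (2 * pi) ^- n * \int[lebn]_t (k x t * expR (- (s ^+ 2 / 2 * dotp t t))).
Proof.
move=> s0; pose e (t : 'rV[R]_n) := expR (- (s ^+ 2 / 2 * dotp t t)).
have ie : lebn.-integrable setT (EFin \o e).
  by apply: integrable_expR_dotp; rewrite mulr_gt0// exprn_gt0.
have me := integrable_measurable_real ie.
pose f (z : T * 'rV[R]_n) := cos (dotp z.2 (x - Z z.1)) * e z.2.
have mf : measurable_fun setT f.
  apply: measurable_funM; last exact: measurableT_comp.
  apply: measurableT_comp; first exact: measurable_cos.
  apply: measurable_dotp; first exact: measurable_snd.
  exact: (measurableT_comp (measurable_shift x) measurable_fst).
have fe w t : `|f (w, t)| <= e t.
  by rewrite normrM (ger0_norm (expR_ge0 _)) ler_piMl ?expR_ge0// cos_abs_le1.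
have iw w : lebn.-integrable setT (EFin \o (fun t => f (w, t))).
  by apply: (le_Rintegrable _ (fe w)) => //; exact: measurableT_comp.
transitivity (\int[P]_w ((2 * pi) ^- n * \int[lebn]_t f (w, t))).
  by apply: eq_Rintegral => w _; rewrite gauss_rV_inversion.
have iP : P.-integrable setT (EFin \o (fun w => \int[lebn]_t f (w, t))).
  apply: (@integrable_bounded _ _ _ _ _ (\int[lebn]_t e t)).
    (* Adding the majorant [e] makes the integrand nonnegative, so that
       [measurable_Rintegral_section] applies; its integral is subtracted afterwards. *)
    have mf' : measurable_fun setT (fun z => f z + e z.2).
      by apply: measurable_funD => //; exact: measurableT_comp.
    have f0 z : 0 <= f z + e z.2.
      by case: z => w t; have := fe w t; rewrite ler_norml /= => /andP[]; lra.
    have := measurable_Rintegral_section lebn mf' f0.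
    move=> /measurable_funB/(_ (measurable_cst (\int[lebn]_t e t))).
    by apply: eq_measurable_fun => w _ /=; rewrite RintegralD// addrK.
  move=> w; apply: (le_trans (le_normr_Rintegral measurableT (iw w))).
  by apply: le_Rintegral => //; exact: (integrable_norm (iw w)).
rewrite RintegralZl//; congr (_ * _).
rewrite (Rintegral_Fubini_bounded P mf fe ie); apply: eq_Rintegral => t _.
by rewrite kE -RintegralZr//; exact: integrable_cos_shift.
Qed.

Variable M : R.
Hypothesis cf0 : forall t, M < enorm t -> C t = 0 /\ S t = 0.

(** The ball of radius [M] is replaced by the cube around it, whose indicator is a product and hence
    integrable by the product formula. *)
Let dom (t : 'rV[R]_n) : R := \prod_(i < n) \1_`[- M, M] (t ord0 i).

Let dom_ge0 t : 0 <= dom t.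
Proof. by apply: prodr_ge0 => i _; rewrite indicE. Qed.

Let integrable_dom : lebn.-integrable setT (EFin \o dom).
Proof. exact: (Rintegral_lebesgue_rV_prod (fun=> integrable_indic_itv (- M) M true false)).1. Qed.

Let dom1 t : enorm t <= M -> dom t = 1.
Proof.
move=> tM; rewrite /dom big1// => i _; rewrite indicE mem_set//= in_itv /= -ler_norml.
exact: le_trans (abs_coord_le_enorm _ _) tM.
Qed.

(** The characteristic function is 1 at the origin, so the origin cannot lie in the region where it
    vanishes. *)
Let M_ge0 : 0 <= M.
Proof.
rewrite leNgt; apply/negP => M0; have [] : C 0 = 0 /\ S 0 = 0 by apply: cf0; rewrite enorm0.
rewrite /C /re_cf; under eq_Rintegral do rewrite dotp0l cos0.
by rewrite Rintegral_probability_cst => /eqP; rewrite oner_eq0.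
Qed.

Let k0 x t : M < enorm t -> k x t = 0.
Proof. by move=> /cf0[Ct St]; rewrite /k Ct St !mulr0 addr0. Qed.

Let k_dom x t : `|k x t| <= dom t.
Proof.
have [tM|Mt] := leP (enorm t) M; first by rewrite dom1// k_le1.
by rewrite k0// normr0.
Qed.

Let integrable_k x : lebn.-integrable setT (EFin \o k x).
Proof. exact: (le_Rintegrable (measurable_k x) (k_dom x)). Qed.

Definition fourier_density (x : 'rV[R]_n) : R :=
  (2 * pi) ^- n * \int[lebn]_t (cos (dotp t x) * re_cf P Z t + sin (dotp t x) * im_cf P Z t).

Let p := fourier_density.

Let twopi_ge0 : 0 <= (2 * pi) ^- n :> R.
Proof. by rewrite invr_ge0 exprn_ge0// mulr_ge0 ?pi_ge0. Qed.

(** Uniformity in both [s] and [x] is the point: it supplies the majorant for s -> 0 under an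
    integral in x. *)
Let q_bound s x : 0 < s -> `|q s x| <= (2 * pi) ^- n * \int[lebn]_t dom t.
Proof.
move=> s0; rewrite q_fourier// normrM ger0_norm// ler_wpM2l//.
have ie : lebn.-integrable setT (EFin \o (fun t : 'rV[R]_n => expR (- (s ^+ 2 / 2 * dotp t t)))).
  by apply: integrable_expR_dotp; rewrite mulr_gt0// exprn_gt0.
have h t : `|k x t * expR (- (s ^+ 2 / 2 * dotp t t))| <= dom t.
  rewrite normrM (ger0_norm (expR_ge0 _)); apply: le_trans (k_dom x t).
  rewrite ler_piMr// -expR0 ler_expR oppr_le0 mulr_ge0 ?dotp_ge0//.
  by rewrite mulr_ge0 ?sqr_ge0.
have ik : lebn.-integrable setT (EFin \o (fun t => k x t * expR (- (s ^+ 2 / 2 * dotp t t)))).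
  apply: (le_Rintegrable _ h) => //; apply: measurable_funM => //.
  exact: integrable_measurable_real ie.
apply: (le_trans (le_normr_Rintegral measurableT ik)).
by apply: le_Rintegral => //; exact: (integrable_norm ik).
Qed.

Let q_cvg x : q k.+1%:R^-1 x @[k --> \oo] --> p x.
Proof.
under eq_fun do rewrite q_fourier ?invr_gt0//.
apply: cvgMr; apply: (Rintegral_dominated_cvg _ _ integrable_dom) => [m|t|m t].
- apply: measurable_funM => //; apply: integrable_measurable_real.
  by apply: (@integrable_expR_dotp _ n); rewrite mulr_gt0// exprn_gt0// invr_gt0.
- rewrite -[X in _ --> X]mulr1 -[X in _ * X]expR0; apply: cvgMr.
  apply: continuous_cvg; first exact: continuous_expR.
  rewrite -oppr0 -[X in _ --> - X](mul0r (dotp t t)); apply: cvgN; apply: cvgMl.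
  rewrite -[X in _ --> X](mul0r (2^-1 : R)); apply: cvgMl.
  rewrite -[X in _ --> X](expr0n _ 2); apply: (cvg_comp _ (fun x => x ^+ 2)).
    exact: cvg_harmonic.
  exact: exprn_continuous.
- rewrite normrM (ger0_norm (expR_ge0 _)); apply: le_trans (k_dom x t).
  rewrite ler_piMr// -expR0 ler_expR oppr_le0 mulr_ge0 ?dotp_ge0//.
Qed.

(** The inversion integral has no evident sign; nonnegativity passes to the limit from the averages
    [q] of Gaussians. *)
Lemma fourier_density_ge0 x : 0 <= fourier_density x.
Proof. by apply: (cvgr_to_ge (@q_cvg x)); apply: nearW => m; exact: q_ge0. Qed.

Lemma measurable_fourier_density : measurable_fun setT fourier_density.
Proof. by apply: (measurable_fun_cvg (fun m => measurable_q m.+1%:R^-1)) => x _; exact: q_cvg. Qed.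

Lemma fourier_density_le x : fourier_density x <= (2 * pi) ^- n * \int[lebn]_t dom t.
Proof.
rewrite /fourier_density ler_wpM2l//; apply: le_Rintegral => //.
  exact: integrable_k.
by move=> t _; apply: le_trans (k_dom x t); exact: ler_norm.
Qed.

(** On the support |t| <= M the integrand is Lipschitz in x with constant |t| <= M, because it is an
    average of cos <t, x - Z>; so the density is Lipschitz. *)
Lemma continuous_fourier_density : continuous fourier_density.
Proof.
apply: (@Lipschitz_enorm_continuous _ _ _ ((2 * pi) ^- n * (M * \int[lebn]_t dom t))) => x y.
rewrite -mulrBr normrM ger0_norm// -!mulrA ler_wpM2l//.
have ix := integrable_k x; have iy := integrable_k y.
rewrite -RintegralB//; apply: (le_trans (le_normr_Rintegral _ _)) => //.
  exact: (integrableB measurableT ix iy).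
have -> : M * ((\int[lebn]_t dom t) * enorm (x - y)) =
    \int[lebn]_t (M * enorm (x - y) * dom t).
  by rewrite RintegralZl//; ring.
apply: le_Rintegral => //.
- exact: (integrable_norm (integrableB measurableT ix iy)).
- have := integrableZl measurableT (M * enorm (x - y)) integrable_dom.
  by apply: eq_integrable.
move=> t _; have [tM|Mt] := leP (enorm t) M; last first.
  rewrite [X in X - _](k0 x Mt) [X in _ - X](k0 y Mt) subrr normr0.
  by rewrite !mulr_ge0 ?enorm_ge0.
rewrite dom1// mulr1 [X in X - _](kE x t) [X in _ - X](kE y t) -RintegralB//.
rewrite -[leRHS](Rintegral_probability_cst P).
apply: (le_trans (le_normr_Rintegral _ _)) => //.
  exact: (integrableB measurableT (integrable_cos_shift x t) (integrable_cos_shift y t)).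
apply: le_Rintegral => //.
- by apply: integrable_norm; exact: (integrableB measurableT
    (integrable_cos_shift x t) (integrable_cos_shift y t)).
- by apply: (integrable_bounded P (M := `|M * enorm (x - y)|)).
move=> w _; apply: (le_trans (cos_Lipschitz _ _)).
rewrite -dotpBr opprB addrA subrK; apply: (le_trans (Cauchy_Schwarz_dotp _ _)).
by rewrite ler_wpM2r ?enorm_ge0.
Qed.

Lemma normal_pdf_shift (s m x : R) : s != 0 -> normal_pdf 0 s (x - m) = normal_pdf m s x.
Proof.
by move=> s0; rewrite !normal_pdfE// (normal_fun_center m).
Qed.

(** * Testing the inverse transform against products of Lipschitz functions *)

Section test_functions.
Variables (g : 'I_n -> R -> R) (L : R).
Hypothesis g_ge0 : forall i x, 0 <= g i x.
Hypothesis g_le1 : forall i x, g i x <= 1.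
Hypothesis g_Lip : forall i x y, `|g i x - g i y| <= L * `|x - y|.
Hypothesis ig : forall i, leb.-integrable setT (EFin \o g i).

Let mg i : measurable_fun setT (g i).
Proof. exact: integrable_measurable_real (ig i). Qed.

Let G (x : 'rV[R]_n) : R := \prod_(i < n) g i (x ord0 i).

Let G_ge0 x : 0 <= G x. Proof. by apply: prodr_ge0 => i _. Qed.

Let iG : lebn.-integrable setT (EFin \o G).
Proof. exact: (Rintegral_lebesgue_rV_prod ig).1. Qed.

Let mG : measurable_fun setT G := integrable_measurable_real iG.

Let gs s m i := \int[leb]_u (g i u * normal_pdf m s u).

Let gs_ge0 s m i : 0 <= gs s m i.
Proof. by apply: Rintegral_ge0 => u _; rewrite mulr_ge0 ?normal_pdf_ge0. Qed.

Let g_abs i x : `|g i x| <= 1. Proof. by rewrite ger0_norm. Qed.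

Let gs_le1 s m i : gs s m i <= 1.
Proof.
rewrite -(Rintegral_normal_pdf m s); apply: le_Rintegral => //.
- exact: (integrable_normal_pdf_mul _ _ (mg i) (g_abs i)).
- exact: integrable_normal_pdf.
by move=> u _; rewrite ler_piMl ?normal_pdf_ge0.
Qed.

Let G_gauss s w : 0 < s ->
  \int[lebn]_x (G x * gauss_rV s (x - Z w)) = \prod_(i < n) gs s (Z w ord0 i) i.
Proof.
move=> s0; have := @Rintegral_lebesgue_rV_prod R n
  (fun i u => g i u * normal_pdf (Z w ord0 i) s u).
move=> [i|_ <-].
  exact: (integrable_normal_pdf_mul _ _ (mg i) (g_abs i)).
apply: eq_Rintegral => x _; rewrite big_split; congr (_ * _).
by apply: eq_bigr => i _; rewrite !mxE normal_pdf_shift// gt_eqF.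
Qed.

(** Fubini moves the smoothing from the law of [Z] onto the test function, where it acts on each
    coordinate separately. *)
Let G_smoothed s : 0 < s ->
  \int[P]_w (\prod_(i < n) gs s (Z w ord0 i) i) = \int[lebn]_x (G x * q s x).
Proof.
move=> s0; have peak0 : 0 <= normal_peak s ^+ n by rewrite exprn_ge0// normal_peak_ge0.
have gle (x : 'rV[R]_n) : gauss_rV s x <= normal_peak s ^+ n.
  rewrite gauss_rVE; last by rewrite gt_eqF.
  rewrite ler_piMr// -expR0 ler_expR oppr_le0.
  by rewrite mulr_ge0 ?dotp_ge0// invr_ge0 mulrn_wge0// sqr_ge0.
pose f (z : T * 'rV[R]_n) := G z.2 * gauss_rV s (z.2 - Z z.1).
have mf : measurable_fun setT f.
  apply: measurable_funM; first exact: measurableT_comp.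
  exact: measurable_gauss_swap.
have fh w x : `|f (w, x)| <= normal_peak s ^+ n * G x.
  by rewrite /f /= ger0_norm ?mulr_ge0 ?gauss_rV_ge0// [leRHS]mulrC ler_wpM2l.
have ih : lebn.-integrable setT (EFin \o (fun x => normal_peak s ^+ n * G x)).
  have := integrableZl measurableT (normal_peak s ^+ n) iG.
  by apply: eq_integrable.
under eq_Rintegral do rewrite -G_gauss//.
rewrite (Rintegral_Fubini_bounded P mf fh ih); apply: eq_Rintegral => x _.
rewrite /f /= RintegralZl//; apply: (integrable_bounded P (M := normal_peak s ^+ n)).
  exact: (measurableT_comp (measurable_gauss_pair s) (pair1_measurable x)).
by move=> w; rewrite ger0_norm ?gauss_rV_ge0.
Qed.

(** Both sides are limits of one sequence. On the left the smoothed factors converge at rate L sqrt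
    2 s; on the right [q] converges pointwise to the density, with majorant a multiple of [G] by
    [q_bound]. *)
Lemma Rintegral_test_fourier_density :
  \int[P]_w (\prod_(i < n) g i (Z w ord0 i)) =
  \int[lebn]_x (\prod_(i < n) g i (x ord0 i) * fourier_density x).
Proof.
have mGZ : measurable_fun setT (fun w => G (Z w)) by exact: measurableT_comp.
have c1 : \int[P]_w (\prod_(i < n) gs k.+1%:R^-1 (Z w ord0 i) i) @[k --> \oo] -->
    \int[P]_w G (Z w).
  apply: (@Rintegral_dominated_cvg _ _ _ _ _ _ (cst 1)) => [m|w||m w].
  - under eq_fun do rewrite -G_gauss//.
    apply: (measurable_Rintegral_section lebn
      (f := fun z => G z.2 * gauss_rV m.+1%:R^-1 (z.2 - Z z.1))).
      apply: measurable_funM; first exact: measurableT_comp.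
      exact: measurable_gauss_swap.
    by move=> z; rewrite mulr_ge0 ?gauss_rV_ge0.
  - apply: cvg_prod_seq => i; apply/subr_cvg0; apply: norm_cvg0.
    apply: (@squeeze_cvgr _ _ _ _ (cst 0) (fun m => L * Num.sqrt 2 * m.+1%:R^-1)).
    + apply: nearW => m; rewrite normr_ge0 /= -mulrA.
      exact: (Rintegral_normal_pdf_approx _ _ (mg i) (g_abs i) (g_Lip i)).
    + exact: cvg_cst.
    + by rewrite -[X in _ --> X](mulr0 (L * Num.sqrt 2)); apply: cvgMr; exact: cvg_harmonic.
  - by apply: (integrable_bounded P (M := 1)) => // w; rewrite normr1.
  - rewrite ger0_norm ?prodr_ge0//; apply: prodr_ile1 => i _.
    by rewrite gs_ge0 gs_le1.
have c2 : \int[lebn]_x (G x * q k.+1%:R^-1 x) @[k --> \oo] -->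
    \int[lebn]_x (G x * fourier_density x).
  pose K := (2 * pi) ^- n * \int[lebn]_t dom t.
  apply: (@Rintegral_dominated_cvg _ _ _ _ _ _ (fun x => K * G x)) => [m|x||m x].
  - by apply: measurable_funM => //; exact: measurable_q.
  - by apply: cvgMr; exact: q_cvg.
  - have := integrableZl measurableT K iG.
    by apply: eq_integrable.
  - rewrite normrM (ger0_norm (G_ge0 _)) mulrC ler_wpM2r//.
    by apply: q_bound; rewrite invr_gt0.
move: c1; under eq_fun do rewrite G_smoothed ?invr_gt0//; move=> c1.
exact: (cvg_unique _ c1 c2).
Qed.

End test_functions.

End inversion.

(** * Tent functions and open boxes *)

Section tent.
Context (R : realType).
Implicit Types a b c x y K : R.

(** A trapezoid of slope K cut off at height 1. As K grows it increases to the indicator of the open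
    interval; for b <= a it is identically 0, like that indicator. *)
Definition tent a b K x : R := Num.max 0 (Num.min 1 (K * Num.min (x - a) (b - x))).

Lemma tent_ge0 a b K x : 0 <= tent a b K x.
Proof. by rewrite le_max lexx. Qed.

Lemma tent_le1 a b K x : tent a b K x <= 1.
Proof. by rewrite ge_max ler01 ge_min lexx. Qed.

Lemma maxr_Lipschitz c x y : `|Num.max c x - Num.max c y| <= `|x - y|.
Proof.
by case: (leP c x) => ?; case: (leP c y) => ?; rewrite ler_norml;
  have := ler_norm (x - y); have := ler_norm (y - x); rewrite distrC;
  move=> *; apply/andP; split; lra.
Qed.

Lemma minr_Lipschitz x y x' y' c : `|x - x'| <= c -> `|y - y'| <= c ->
  `|Num.min x y - Num.min x' y'| <= c.
Proof.
rewrite !ler_norml => /andP[? ?] /andP[? ?].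
by case: (leP x y) => ?; case: (leP x' y') => ?; apply/andP; split; lra.
Qed.

Lemma tent_Lipschitz a b K x y : 0 <= K -> `|tent a b K x - tent a b K y| <= K * `|x - y|.
Proof.
move=> K0; apply: (le_trans (maxr_Lipschitz _ _ _)); apply: minr_Lipschitz.
  by rewrite subrr normr0 mulr_ge0.
rewrite -mulrBr normrM ger0_norm// ler_wpM2l//; apply: minr_Lipschitz.
  by rewrite opprB addrA subrK.
by rewrite opprB addrC addrA subrK distrC.
Qed.

Lemma tent_out a b K x : 0 <= K -> ~~ (x \in `]a, b[) -> tent a b K x = 0.
Proof.
move=> K0; rewrite in_itv /= => nab; apply/max_idPl; rewrite ge_min; apply/orP; right.
rewrite mulr_ge0_le0// ge_min; move: nab; rewrite negb_and -!leNgt => /orP[]; lra.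
Qed.

Lemma measurable_tent a b K : measurable_fun setT (tent a b K).
Proof.
apply: measurable_maxr => //; apply: measurable_minr => //; apply: measurable_funM => //.
by apply: measurable_minr; apply: measurable_funB.
Qed.

Lemma tent_le_indic a b K x : 0 <= K -> tent a b K x <= \1_`[a, b] x.
Proof.
move=> K0; have [xab|xab] := boolP (x \in `]a, b[); last by rewrite tent_out.
by rewrite indicE mem_set ?tent_le1//; exact: subset_itv_oo_cc.
Qed.

Lemma integrable_tent a b K : 0 <= K ->
  (@lebesgue_measure R).-integrable setT (EFin \o tent a b K).
Proof.
move=> K0; apply: (@le_Rintegrable _ (measurableTypeR R) _ _ _ \1_`[a, b]).
- exact: measurable_tent.
- by move=> x; rewrite ger0_norm ?tent_ge0// tent_le_indic.
- exact: integrable_indic_itv.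
Qed.

Lemma cvg_tent a b x : tent a b k.+1%:R x @[k --> \oo] --> (\1_`]a, b[ x : R).
Proof.
have [xab|xab] := boolP (x \in `]a, b[); last first.
  rewrite indicE memNset; last by apply/negP.
  by under eq_fun do rewrite tent_out//; exact: cvg_cst.
rewrite indicE mem_set//; apply: cvg_near_cst.
move: xab; rewrite in_itv /= => /andP[ax xb].
pose m := Num.min (x - a) (b - x); have m0 : 0 < m by rewrite lt_min !subr_gt0 ax.
(* [m] is the distance from x to the complement of the interval; the tent equals 1 at x as soon as
   (k + 1) m >= 1. *)
exists (Num.truncn m^-1) => // k /= mk.
apply/eqP; rewrite eq_le tent_le1 /tent le_max; apply/orP; right.
rewrite le_min lexx -/m -ler_pdivrMr// mul1r ltW//.
by rewrite (lt_le_trans (truncnS_gt _))// ler_nat ltnS.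
Qed.

End tent.

Section open_boxes.
Context (R : realType) (n : nat).

Definition open_box (a b : 'I_n -> R) : set 'rV[R]_n :=
  [set v | forall i, v ord0 i \in `]a i, b i[].

Lemma measurable_open_box a b : measurable (open_box a b).
Proof. exact: (@measurable_box R n (fun i => `]a i, b i[%classic)). Qed.

Lemma prod_indic_open_box a b (v : 'rV[R]_n) :
  \prod_(i < n) \1_`]a i, b i[ (v ord0 i) = \1_(open_box a b) v :> R.
Proof.
have [/set_mem vab|vab] := boolP (v \in open_box a b).
  rewrite indicE mem_set// big1// => i _; rewrite indicE mem_set//; exact: vab.
rewrite indicE (negbTE vab); move/negP : vab; rewrite inE => /existsNP[i vi].
by rewrite (bigD1 i)//= indicE memNset// mul0r.
Qed.

(** Bounds with [b i <= a i] are allowed and give the empty set, so disjoint boxes need no separate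
    case. *)
Lemma open_boxI_closed : setI_closed [set A | exists a b, A = open_box a b].
Proof.
move=> _ _ [a [b ->]] [a' [b' ->]].
exists (fun i => Num.max (a i) (a' i)), (fun i => Num.min (b i) (b' i)).
apply/seteqP; split => v.
  move=> [h h'] i; have := h i; have := h' i; rewrite !in_itv /= => /andP[? ?] /andP[? ?].
  by rewrite gt_max lt_min; apply/andP; split; apply/andP; split.
move=> h; split => i; have := h i; rewrite !in_itv /= gt_max lt_min;
  by move=> /andP[/andP[? ?] /andP[? ?]]; apply/andP; split.
Qed.

Lemma open_box_ub (v : 'rV[R]_n) : exists m, forall i, `|v ord0 i| < m.+1%:R.
Proof.
exists (Num.truncn (\sum_i `|v ord0 i|)) => i.
by rewrite (le_lt_trans _ (truncnS_gt _))// (bigD1 i)//= lerDl sumr_ge0.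
Qed.

Lemma open_box_cover : \bigcup_m open_box (fun=> - m.+1%:R) (fun=> m.+1%:R) = setT.
Proof.
rewrite -subTset => v _; have [m vm] := open_box_ub v; exists m => // i.
by rewrite in_itv /= -ltr_norml.
Qed.

(** It suffices to generate the preimages of rays under the coordinates: the half-space x < v_i is
    the union over m of boxes with lower bound x in direction i and all other bounds at distance m +
    1 from 0. *)
Lemma measurable_open_box_generated :
  measurable `<=` <<s [set A : set 'rV[R]_n | exists a b, A = open_box a b]>>.
Proof.
set G := [set A | _]; apply: smallest_sub; first exact: smallest_sigma_algebra.
move=> A; rewrite -bigcup_seq => -[i /= _ [B mB <-]]; rewrite setTI.
have {}mB : (@RGenOInfty.G R).-sigma.-measurable B by rewrite -RGenOInfty.measurableE.
move: B mB.
apply: (@smallest_sub _ _ _ [set B | <<s G >> ((fun x : 'rV[R]_n => x ord0 i) @^-1` B)]).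
  split => /=.
  - by rewrite preimage_set0; exact: sigma_algebra0.
  - by move=> B; rewrite setTD preimage_setC; exact: sigma_algebraC.
  - by move=> F mF; rewrite preimage_bigcup; exact: sigma_algebra_bigcup.
move=> _ [x ->] /=.
rewrite (_ : _ @^-1` _ = \bigcup_m open_box
    (fun j => if j == i then x else - m.+1%:R) (fun=> m.+1%:R)).
  apply: sigma_algebra_bigcup => m; apply: sub_sigma_algebra.
  by eexists; eexists; reflexivity.
apply/seteqP; split => v /=; rewrite in_itv /= andbT.
  move=> xv; have [m vm] := open_box_ub v; exists m => // j; rewrite in_itv /=.
  have := vm j; rewrite ltr_norml => /andP[? ->]; rewrite andbT.
  by case: eqP => [->|].
by move=> [m _ /(_ i)]; rewrite in_itv /= eqxx => /andP[].
Qed.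

End open_boxes.

Section density_from_characteristic_function.
Context d (T : measurableType d) (R : realType) (P : probability T R) (n : nat).
Variable Z : T -> 'rV[R]_n.
Hypothesis mZ : measurable_fun setT Z.
Variable M : R.
Hypothesis cf0 : forall t, M < enorm t -> re_cf P Z t = 0 /\ im_cf P Z t = 0.
Notation leb := (@lebesgue_measure R).
Notation lebn := (lebesgue_rV R n).
Let p := fourier_density P Z.

Lemma fourier_density_bounded : exists K, forall x, p x <= K.
Proof. by eexists => x; exact: (fourier_density_le mZ cf0). Qed.

Lemma Rintegral_open_box_fourier_density a b :
  \int[P]_w \1_(open_box a b) (Z w) = \int[lebn]_x (\1_(open_box a b) x * p x).
Proof.
have [K pK] := fourier_density_bounded.
have p0 x : 0 <= p x by exact: (fourier_density_ge0 mZ cf0).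
have mp : measurable_fun setT p := measurable_fourier_density mZ cf0.
pose t k i (x : R) := tent (a i) (b i) k.+1%:R x.
have mt k : measurable_fun setT (fun x : 'rV[R]_n => \prod_(i < n) t k i (x ord0 i)).
  apply: measurable_prod => i _; apply: (measurableT_comp (@measurable_tent R _ _ _)).
  exact: measurable_coord.
have t01 k i x : 0 <= t k i x <= 1 by rewrite tent_ge0 tent_le1.
have c1 : \int[P]_w (\prod_(i < n) t k i (Z w ord0 i)) @[k --> \oo] -->
    \int[P]_w (\1_(open_box a b) (Z w) : R).
  apply: (@Rintegral_dominated_cvg _ _ _ _ _ _ (cst 1)) => [k|w||k w].
  - exact: (measurableT_comp (mt k) mZ).
  - by rewrite -prod_indic_open_box; apply: cvg_prod_seq => i; exact: cvg_tent.
  - by apply: (integrable_bounded P (M := 1)) => // w; rewrite normr1.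
  - rewrite ger0_norm ?prodr_ge0//; last by move=> i _; case/andP: (t01 k i (Z w ord0 i)).
    exact: prodr_ile1.
(* On the Lebesgue side the constant 1 is not integrable; the bound [K] of the density times the
   indicator of the closed box dominates instead. *)
pose D (x : 'rV[R]_n) := K * \prod_(i < n) (\1_`[a i, b i] (x ord0 i) : R).
have c2 : \int[lebn]_x (\prod_(i < n) t k i (x ord0 i) * p x) @[k --> \oo] -->
    \int[lebn]_x (\1_(open_box a b) x * p x).
  apply: (@Rintegral_dominated_cvg _ _ _ _ _ _ D) => [k|x||k x].
  - exact: measurable_funM.
  - rewrite -prod_indic_open_box; apply: cvgMl.
    by apply: cvg_prod_seq => i; exact: cvg_tent.
  - have := integrableZl measurableT K (Rintegral_lebesgue_rV_prod
      (fun i => integrable_indic_itv (a i) (b i) true false)).1.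
    by apply: eq_integrable.
  - have pr0 : 0 <= \prod_(i < n) t k i (x ord0 i).
      by apply: prodr_ge0 => i _; case/andP: (t01 k i (x ord0 i)).
    rewrite ger0_norm; last by rewrite mulr_ge0.
    rewrite /D mulrC; apply: ler_pM => //.
    by apply: ler_prod => i _; rewrite tent_ge0 tent_le_indic.
move: c1; under eq_fun.
  move=> k; rewrite (Rintegral_test_fourier_density mZ cf0 (L := k.+1%:R)); first over.
  - by move=> i x; case/andP: (t01 k i x).
  - by move=> i x; case/andP: (t01 k i x).
  - by move=> i x y; exact: tent_Lipschitz.
  - by move=> i; exact: integrable_tent.
by move=> c1; exact: (cvg_unique _ c1 c2).
Qed.

(** Uniqueness of measures on the pi-system of open boxes, exhausted by growing boxes, on which the
    law of [Z] is finite. That the density has total mass 1 is a consequence. *)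
Theorem has_density_fourier_density : has_density P Z p.
Proof.
have p0 x : 0 <= p x by exact: (fourier_density_ge0 mZ cf0).
have mp : measurable_fun setT p := measurable_fourier_density mZ cf0.
have mpE : measurable_fun setT (EFin \o p) by exact/measurable_EFinP.
split => // A mA.
pose nu (B : set 'rV[R]_n) := (\int[lebn]_(x in B) (p x)%:E)%E.
have nu0 : nu set0 = 0%E by rewrite /nu integral_set0.
have nu_ge0 B : (0 <= nu B)%E by apply: integral_ge0 => x _; rewrite lee_fin.
have nu_add : semi_sigma_additive nu.
  by apply: semi_sigma_additive_nng_induced => // x; rewrite lee_fin.
pose m2 : {measure set 'rV[R]_n -> \bar R} :=
  HB.pack nu (isMeasure.Build _ _ _ nu nu0 nu_ge0 nu_add).
pose m1 : {measure set 'rV[R]_n -> \bar R} :=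
  measure_function_pushforward__canonical__measure_function_Measure P mZ.
apply: (@g_sigma_algebra_measure_unique _ _ _
  [set A : set 'rV[R]_n | exists a b, A = open_box a b] _
  (fun m => open_box (fun=> - m.+1%:R) (fun=> m.+1%:R)) _ _ m1 m2).
- by move=> _ [a [b ->]]; exact: measurable_open_box.
- by move=> m; do 2 eexists; reflexivity.
- exact: open_box_cover.
- exact: open_boxI_closed.
- move=> _ [a [b ->]]; rewrite /m1 /m2 /= /pushforward /nu.
  have [K pK] := fourier_density_bounded.
  have mb := @measurable_open_box R n a b.
  have mZb : measurable (Z @^-1` open_box a b).
    by rewrite -[X in measurable X]setTI; exact: mZ.
  have ib : lebn.-integrable setT (EFin \o (fun x => \1_(open_box a b) x * p x)).
    have iD := (Rintegral_lebesgue_rV_prod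
      (fun i => integrable_indic_itv (a i) (b i) false true)).1.
    have iKD := integrableZl measurableT K iD.
    apply: (@le_Rintegrable _ _ _ _ _
      (fun x : 'rV[R]_n => K * \prod_(i < n) \1_`]a i, b i[ (x ord0 i))).
    + by apply: measurable_funM => //; exact: measurable_indic.
    + move=> x; rewrite prod_indic_open_box ger0_norm; last by apply: mulr_ge0; rewrite ?indicE.
      by rewrite mulrC ler_wpM2r// indicE.
    + by move: iKD; apply: eq_integrable.
  rewrite integral_mkcond.
  transitivity ((\int[lebn]_x (\1_(open_box a b) x * p x))%:E).
    rewrite -Rintegral_open_box_fourier_density EFin_Rintegral; last first.
      apply: (integrable_bounded P (M := 1)); last first.
        by move=> w; rewrite ger0_norm// indicE; case: (_ \in _).
      by apply: (measurableT_comp _ mZ); exact: measurable_indic.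
    have := integral_indic P measurableT mZb; rewrite setIT => <-.
    by apply: eq_integral => w _; rewrite !indicE.
  rewrite EFin_Rintegral//; apply: eq_integral => x _.
  by rewrite patchE indicE; case: ifP => _; rewrite ?mul1r ?mul0r.
- move=> m; apply: (@le_lt_trans _ _ 1%E); last by rewrite ltry.
  rewrite /m1 /= /pushforward; apply: probability_le1.
  rewrite -[X in measurable X]setTI; apply: mZ => //; exact: measurable_open_box.
- exact: measurable_open_box_generated.
Qed.

End density_from_characteristic_function.

(** * Sums of independent vectors *)

Section independence.
Context d (T : measurableType d) (R : realType) (P : probability T R).

Lemma measure_eq_rectangles d1 d2 (T1 : measurableType d1) (T2 : measurableType d2)
    (m1 m2 : {measure set (T1 * T2) -> \bar R}) :
  (m1 setT < +oo)%E ->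
  (forall A B, measurable A -> measurable B -> m1 (A `*` B) = m2 (A `*` B)) ->
  forall C, measurable C -> m1 C = m2 C.
Proof.
move=> m1T m12 C mC.
pose G := [set C : set (T1 * T2) | exists2 A, measurable A & exists2 B, measurable B & A `*` B = C].
apply: (@g_sigma_algebra_measure_unique _ _ _ G _ (fun=> setT) _ _ m1 m2).
- by move=> _ [A mA [B mB <-]]; exact: measurableX.
- by move=> _; exists setT => //; exists setT => //; rewrite setXTT.
- by rewrite bigcup_const//; exists 0%N.
- move=> _ _ [A mA [B mB <-]] [A' mA' [B' mB' <-]].
  exists (A `&` A'); first exact: measurableI.
  by exists (B `&` B'); [exact: measurableI|rewrite setXI].
- by move=> _ [A mA [B mB <-]]; exact: m12.
- by [].
- by rewrite measurable_prod_measurableType in mC.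
Qed.

(** As functions of [C] both sides are finite measures, one a restriction of [P] to [B] and the
    other a multiple of the law of the pair; they agree on rectangles. *)
Lemma indep_pair_event d1 d2 (T1 : measurableType d1) (T2 : measurableType d2)
    (S : T -> T1) (X : T -> T2) (B : set T) :
  measurable_fun setT S -> measurable_fun setT X -> measurable B ->
  (forall A1 A2, measurable A1 -> measurable A2 ->
    P (S @^-1` A1 `&` X @^-1` A2 `&` B) = (P (S @^-1` A1 `&` X @^-1` A2) * P B)%E) ->
  forall C, measurable C ->
    P ((fun w => (S w, X w)) @^-1` C `&` B) = (P ((fun w => (S w, X w)) @^-1` C) * P B)%E.
Proof.
move=> mS mX mB H C mC.
have mSX : measurable_fun setT (fun w => (S w, X w)) by exact: measurable_fun_pair.
pose nu1 : {measure set (T1 * T2) -> \bar R} :=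
  measure_function_pushforward__canonical__measure_function_Measure (mrestr P mB) mSX.
pose r : {nonneg R} := NngNum (fine_ge0 (measure_ge0 P B)).
pose nu : {measure set (T1 * T2) -> \bar R} :=
  measure_function_pushforward__canonical__measure_function_Measure P mSX.
have rE : (r%:num)%:E = P B by rewrite /= fineK// fin_num_measure.
have sE X' : mscale r nu X' = (P ((fun w => (S w, X w)) @^-1` X') * P B)%E.
  by rewrite muleC -rE.
have E : nu1 C = mscale r nu C.
  apply: measure_eq_rectangles => //.
    rewrite /nu1 /= /pushforward /mrestr preimage_setT setTI.
    by rewrite (le_lt_trans (probability_le1 P mB))// ltry.
  move=> A1 A2 mA1 mA2.
  exact: etrans (H _ _ mA1 mA2) (esym (sE _)).
exact: etrans E (sE C).
Qed.

(** Independence identifies the joint law with the product of the two laws, under which the integral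
    factors. *)
Lemma Rintegral_indep d1 d2 (T1 : measurableType d1) (T2 : measurableType d2)
    (U : {RV P >-> T1}) (V : {RV P >-> T2}) (g : T1 -> R) (h : T2 -> R) (M : R) :
  (forall A B, measurable A -> measurable B ->
    P (U @^-1` A `&` V @^-1` B) = (P (U @^-1` A) * P (V @^-1` B))%E) ->
  measurable_fun setT g -> measurable_fun setT h ->
  (forall x, `|g x| <= M) -> (forall x, `|h x| <= M) ->
  \int[P]_w (g (U w) * h (V w)) = \int[P]_w g (U w) * \int[P]_w h (V w).
Proof.
move=> UV mg mh gM hM.
have mU : measurable_fun setT U by [].
have mV : measurable_fun setT V by [].
have mUV : measurable_fun setT (fun w => (U w, V w)) by exact: measurable_fun_pair.
have ig : (distribution P U).-integrable setT (EFin \o g) by exact: integrable_bounded mg gM.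
have ih : (distribution P V).-integrable setT (EFin \o h) by exact: integrable_bounded mh hM.
have [igh E] := Rintegral_prod ig ih.
pose nu : {measure set (T1 * T2) -> \bar R} :=
  measure_function_pushforward__canonical__measure_function_Measure P mUV.
have nuE C : measurable C -> (distribution P U \x distribution P V)%E C = nu C.
  apply: product_measure_unique => A B mA mB.
  exact: UV.
have mgh : measurable_fun setT (fun z : T1 * T2 => g z.1 * h z.2).
  by apply: measurable_funM; exact: measurableT_comp.
have ighP : P.-integrable setT (EFin \o (fun w => g (U w) * h (V w))).
  apply: (integrable_bounded P (M := M * M)).
    by apply: measurable_funM; exact: measurableT_comp.
  by move=> w; rewrite normrM ler_pM.
transitivity (\int[(distribution P U \x distribution P V)%E]_z (g z.1 * h z.2)).
  congr fine; transitivity (\int[nu]_z (g z.1 * h z.2)%:E)%E; last first.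
    by apply: eq_measure_integral => C mC _; rewrite -nuE.
  by rewrite (integral_pushforward mUV)//; exact/measurable_EFinP.
rewrite E; congr (_ * _); congr fine.
  rewrite integral_distribution//; first exact/measurable_EFinP.
  by apply: (integrable_bounded P (M := M)) => //; exact: measurableT_comp.
rewrite integral_distribution//; first exact/measurable_EFinP.
by apply: (integrable_bounded P (M := M)) => //; exact: measurableT_comp.
Qed.

End independence.

Section partial_sums.
Context d (T : measurableType d) (R : realType) (P : probability T R) (n : nat).
Variables (Xs : nat -> {RV P >-> 'rV[R]_n}) (Y : {RV P >-> 'rV[R]_n}).
Hypothesis indepX : mutually_independent Xs.
Hypothesis indepY : independent_of_seq Y Xs.

Definition shifted_sum (k : nat) (w : T) : 'rV[R]_n := Y w + \sum_(j < k) Xs j w.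

Lemma measurable_add_rV (f g : T -> 'rV[R]_n) :
  measurable_fun setT f -> measurable_fun setT g -> measurable_fun setT (fun w => f w + g w).
Proof.
move=> mf mg; apply: measurable_fun_rV => i.
rewrite (_ : (fun _ => _) = (fun w => f w ord0 i + g w ord0 i)).
  by apply: measurable_funD;
    [exact: (measurableT_comp (@measurable_coord R n i) mf)
    |exact: (measurableT_comp (@measurable_coord R n i) mg)].
by apply/funext => w; rewrite mxE.
Qed.

Lemma shifted_sumS k : shifted_sum k.+1 = (fun w => shifted_sum k w + Xs k w).
Proof. by apply/funext => w; rewrite /shifted_sum big_ord_recr addrA. Qed.

Lemma measurable_shifted_sum k : measurable_fun setT (shifted_sum k).
Proof.
elim: k => [|k IH]; last by rewrite shifted_sumS; exact: measurable_add_rV.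
rewrite (_ : shifted_sum 0 = Y); first exact: measurable_funPT.
by apply/funext => w; rewrite /shifted_sum big_ord0 addr0.
Qed.

Let cyl (J : {fset nat}) (E : nat -> set 'rV[R]_n) : set T :=
  \bigcap_(j in [set` J]) (Xs j @^-1` E j).

Let measurable_pre k A : measurable A -> measurable (Xs k @^-1` A).
Proof. by move=> mA; rewrite -[X in measurable X]setTI; exact: measurable_funPT. Qed.

Let measurable_cyl J E : (forall j, measurable (E j)) -> measurable (cyl J E).
Proof.
move=> mE; apply: fin_bigcap_measurable; first exact: finite_fset.
by move=> j _; exact: measurable_pre.
Qed.

Let cyl_fsetU1 (J : {fset nat}) (E : nat -> set 'rV[R]_n) (k : nat) (A : set 'rV[R]_n) :
  (forall j, j \in J -> (k < j)%N) ->
  cyl (k |` J)%fset (fun j => if j == k then A else E j) = Xs k @^-1` A `&` cyl J E.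
Proof.
move=> kJ; apply/seteqP; split => w.
  move=> h; split; first by have := h k; rewrite /= eqxx; apply; rewrite in_fset1U eqxx.
  move=> j /= jJ; have := h j; rewrite /= in_fset1U jJ orbT => /(_ isT).
  by have := kJ _ jJ; rewrite ltn_neqAle eq_sym => /andP[/negbTE ->].
move=> [wA wJ] j /=; rewrite in_fset1U; case: eqP => [-> _ //|_ /= jJ].
exact: wJ.
Qed.

Let indep_cyl (J : {fset nat}) (E : nat -> set 'rV[R]_n) (k : nat) (A : set 'rV[R]_n) :
  (forall j, j \in J -> (k < j)%N) -> measurable A -> (forall j, measurable (E j)) ->
  P (Xs k @^-1` A `&` cyl J E) = (P (Xs k @^-1` A) * P (cyl J E))%E.
Proof.
move=> kJ mA mE; rewrite -cyl_fsetU1//.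
have kNJ : k \notin J by apply/negP => /kJ; rewrite ltnn.
rewrite /cyl !indepX//; last by move=> j; case: ifP.
rewrite big_fsetU1//= eqxx; congr (_ * _)%E; apply: eq_big_seq => j jJ.
by have := kJ _ jJ; rewrite ltn_neqAle eq_sym => /andP[/negbTE ->].
Qed.

(** Independence of the k-th sum from the next vector alone does not survive induction. The claim is
    therefore made against all finite cylinders on indices >= k; the next sum is a function of the
    pair formed by the current sum and [Xs k]. *)
Lemma indep_shifted_sum_cyl k (J : {fset nat}) (E : nat -> set 'rV[R]_n) (A : set 'rV[R]_n) :
  (forall j, j \in J -> (k <= j)%N) -> measurable A -> (forall j, measurable (E j)) ->
  P (shifted_sum k @^-1` A `&` \bigcap_(j in [set` J]) (Xs j @^-1` E j)) =
  (P (shifted_sum k @^-1` A) * P (\bigcap_(j in [set` J]) (Xs j @^-1` E j)))%E.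
Proof.
rewrite -/(cyl J E); elim: k J E A => [|k IH] J E A kJ mA mE.
  rewrite (_ : shifted_sum 0 = Y); last by apply/funext => w; rewrite /shifted_sum big_ord0 addr0.
  (* At k = 0 the sum is [Y], and any cylinder lies in the sigma-algebra generated by the
     sequence. *)
  apply: indepY => //; apply: (@fin_bigcap_measurable _ (g_sigma_algebraType
    (\bigcup_n preimage_set_system setT (Xs n) measurable))); first exact: finite_fset.
  move=> j _; apply: sub_sigma_algebra; exists j => //=; exists (E j) => //.
  by rewrite setTI.
have mS := measurable_shifted_sum k.
have rect A1 A2 : measurable A1 -> measurable A2 ->
    P (shifted_sum k @^-1` A1 `&` Xs k @^-1` A2) =
    (P (shifted_sum k @^-1` A1) * P (Xs k @^-1` A2))%E.
  move=> mA1 mA2; have := IH [fset k]%fset (fun=> A2) A1.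
  rewrite (_ : cyl _ _ = Xs k @^-1` A2); first by apply => // j; rewrite inE => /eqP ->.
  apply/seteqP; split => w; first by move/(_ k); apply; rewrite /= inE.
  by move=> wA j /=; rewrite inE => /eqP ->.
pose C := (fun z : 'rV[R]_n * 'rV[R]_n => z.1 + z.2) @^-1` A.
have mC : measurable C.
  rewrite -[X in measurable X]setTI; suff : measurable_fun setT
    (fun z : 'rV[R]_n * 'rV[R]_n => z.1 + z.2) by apply.
  apply: measurable_fun_rV => i.
  rewrite (_ : (fun _ => _) = (fun z : 'rV[R]_n * 'rV[R]_n => z.1 ord0 i + z.2 ord0 i)).
    by apply: measurable_funD; exact: (measurableT_comp (@measurable_coord R n i)).
  by apply/funext => z; rewrite mxE.
have CE : shifted_sum k.+1 @^-1` A = (fun w => (shifted_sum k w, Xs k w)) @^-1` C.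
  by rewrite shifted_sumS.
rewrite CE; apply: indep_pair_event => //; first exact: measurable_cyl.
move=> A1 A2 mA1 mA2.
have kJ' j : j \in J -> (k < j)%N by exact: kJ.
(* The event of [Xs k] is absorbed into the cylinder, the induction hypothesis splits off the sum,
   and mutual independence separates [Xs k] again. *)
rewrite rect// -setIA -(cyl_fsetU1 E A2 kJ') IH//.
- by rewrite cyl_fsetU1// indep_cyl// muleA.
- by move=> j; rewrite in_fset1U => /predU1P[->//|/kJ' /ltnW].
- by move=> j; case: ifP.
Qed.

Lemma indep_shifted_sum k A B : measurable A -> measurable B ->
  P (shifted_sum k @^-1` A `&` Xs k @^-1` B) =
  (P (shifted_sum k @^-1` A) * P (Xs k @^-1` B))%E.
Proof.
move=> mA mB; have := @indep_shifted_sum_cyl k [fset k]%fset (fun=> B) A.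
rewrite (_ : \bigcap_(j in _) _ = Xs k @^-1` B); first by apply => // j; rewrite inE => /eqP ->.
apply/seteqP; split => w; first by move/(_ k); apply; rewrite /= inE.
by move=> wB j /=; rewrite inE => /eqP ->.
Qed.

End partial_sums.

(** * Second-order expansion of the characteristic function *)

Section trigonometric_remainder.
Context (R : realType).
Implicit Types u x : R.

(** The ladder for the Taylor inequalities below: each one is the integral from 0 of an earlier
    one. *)
Lemma ge0_from_derive (f df : R -> R) : (forall x, is_derive x 1 f (df x)) ->
  (forall x, 0 <= x -> 0 <= df x) -> f 0 = 0 -> forall x, 0 <= x -> 0 <= f x.
Proof.
move=> fdf df0 f0 x x0.
have [|c] := @MVT_segment R f df 0 x x0 (fun z _ => fdf z).
  apply: continuous_subspaceT => z; apply: differentiable_continuous.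
  by apply/derivable1_diffP; have [] := fdf z.
rewrite in_itv /= => /andP[c0 _]; rewrite f0 !subr0 => ->.
by rewrite mulr_ge0// df0.
Qed.

Lemma is_derive_funD (f g : R -> R) x (df dg : R) :
  is_derive x 1 f df -> is_derive x 1 g dg -> is_derive x 1 (fun y => f y + g y) (df + dg).
Proof. by move=> *; exact: is_deriveD. Qed.

Lemma is_derive_funB (f g : R -> R) x (df dg : R) :
  is_derive x 1 f df -> is_derive x 1 g dg -> is_derive x 1 (fun y => f y - g y) (df - dg).
Proof. by move=> *; exact: is_deriveB. Qed.

Lemma sin_le_id x : 0 <= x -> 0 <= x - sin x.
Proof.
have d (y : R) := is_derive_funB (is_derive_id y 1) (is_derive_sin y).
apply: (ge0_from_derive d) => [y _|]; first by rewrite subr_ge0 cos_le1.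
by rewrite sin0 subrr.
Qed.

Lemma is_derive_half_sqr x : is_derive x 1 (fun x : R => x ^+ 2 / 2) x.
Proof.
rewrite (_ : (fun x => _) = ((id : R -> R) ^+ 2) * cst (2^-1)); last by apply/funext.
by apply: is_derive_eq; rewrite /= /GRing.scale /=; field.
Qed.

Lemma is_derive_sixth_cube x : is_derive x 1 (fun x : R => x ^+ 3 / 6) (x ^+ 2 / 2).
Proof.
rewrite (_ : (fun x => _) = ((id : R -> R) ^+ 3) * cst (6^-1)); last by apply/funext.
by apply: is_derive_eq; rewrite /= /GRing.scale /=; field.
Qed.

Let is_derive_cos1 x := is_derive_funB (is_derive_cos x) (is_derive_cst (1 : R) x 1).

Let is_derive_cos_quadratic x := is_derive_funD (is_derive_cos1 x) (is_derive_half_sqr x).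

Lemma cos_quadratic_ge0 x : 0 <= x -> 0 <= cos x - 1 + x ^+ 2 / 2.
Proof.
apply: (ge0_from_derive is_derive_cos_quadratic) => [y y0|].
  by rewrite subr0 addrC sin_le_id.
by rewrite cos0 subrr add0r expr0n mul0r.
Qed.

Lemma sin_cubic_ge0 x : 0 <= x -> 0 <= sin x - x + x ^+ 3 / 6.
Proof.
have d (y : R) := is_derive_funD (is_derive_funB (is_derive_sin y) (is_derive_id y 1))
  (is_derive_sixth_cube y).
apply: (ge0_from_derive d) => [y y0|]; first exact: cos_quadratic_ge0.
by rewrite sin0 subrr add0r expr0n mul0r.
Qed.

(** Start of a second chain, from sin <= 1, which ends with the cubic upper bound on cos x - 1 +
    x^2/2. *)
Lemma cos_linear_ge0 x : 0 <= x -> 0 <= x - 1 + cos x.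
Proof.
have d (y : R) := is_derive_funD (is_derive_funB (is_derive_id y 1) (is_derive_cst (1 : R) y 1))
  (is_derive_cos y).
apply: (ge0_from_derive d) => [y _|]; first by rewrite subr0 subr_ge0 sin_le1.
by rewrite cos0 sub0r addNr.
Qed.

Lemma sin_quadratic_ge0 x : 0 <= x -> 0 <= x ^+ 2 / 2 - x + sin x.
Proof.
have d (y : R) := is_derive_funD (is_derive_funB (is_derive_half_sqr y) (is_derive_id y 1))
  (is_derive_sin y).
apply: (ge0_from_derive d) => [y y0|]; first exact: cos_linear_ge0.
by rewrite sin0 expr0n mul0r subrr addr0.
Qed.

Lemma cos_cubic_ge0 x : 0 <= x -> 0 <= x ^+ 3 / 6 - (cos x - 1 + x ^+ 2 / 2).
Proof.
have d (y : R) := is_derive_funB (is_derive_sixth_cube y) (is_derive_cos_quadratic y).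
apply: (ge0_from_derive d) => [y y0|].
  by have := sin_quadratic_ge0 y0; rewrite /=; lra.
by rewrite cos0 !expr0n /=; lra.
Qed.

(** The absolute real and imaginary parts of exp(iu) - (1 + iu - u^2/2), added up. *)
Definition trig_rem u : R := `|cos u - 1 + u ^+ 2 / 2| + `|sin u - u|.

Lemma trig_remN u : trig_rem (- u) = trig_rem u.
Proof.
rewrite /trig_rem cosN sinN sqrrN; congr (_ + _).
by rewrite -[LHS]normrN; congr Num.norm; ring.
Qed.

(** The quadratic bound is the integrable majorant when only second moments exist; the cubic one
    gives smallness near 0 and, with third moments, the explicit radius. *)
Lemma trig_rem_le u : trig_rem u <= u ^+ 2 /\ trig_rem u <= `|u| ^+ 3 / 3.
Proof.
wlog u0 : u / 0 <= u.
  move=> H; have [|/ltW u0] := leP 0 u; first exact: H.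
  by rewrite -trig_remN -sqrrN -normrN; apply: H; rewrite oppr_ge0.
rewrite /trig_rem (ger0_norm u0) (ger0_norm (cos_quadratic_ge0 u0)).
rewrite ler0_norm; last by rewrite -oppr_ge0 opprB sin_le_id.
have := cos_quadratic_ge0 u0; have := sin_cubic_ge0 u0; have := sin_quadratic_ge0 u0.
have := cos_cubic_ge0 u0; have := @cos_le1 R u.
by move=> *; split; lra.
Qed.

Lemma trig_rem_ge0 u : 0 <= trig_rem u.
Proof. by rewrite addr_ge0. Qed.

Lemma measurable_trig_rem : measurable_fun setT trig_rem.
Proof.
apply: measurable_funD; apply: measurableT_comp => //.
  apply: measurable_funD.
    by apply: measurable_funB => //; exact: measurable_cos.
  by apply: measurable_funM => //; exact: measurable_funX.
by apply: measurable_funB => //; exact: measurable_sin.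
Qed.

End trigonometric_remainder.

Section moments.
Context d (T : measurableType d) (R : realType) (P : probability T R) (n : nat).
Variable X : {RV P >-> 'rV[R]_n}.
Hypothesis X0 : mean_zero X.
Hypothesis Xiso : isotropic X.

Let mX : measurable_fun setT X. Proof. exact: measurable_funPT. Qed.

Lemma integrable_sqr_dotp_RV t : P.-integrable setT (EFin \o (fun w => dotp t (X w) ^+ 2)).
Proof.
apply/integrableP; split.
  by apply/measurable_EFinP; apply: measurable_funX; exact: measurable_dotp_RV.
under eq_integral do rewrite /= ger0_norm ?sqr_ge0// dotpC.
by have := Xiso t; rewrite unlock => ->; rewrite ltry.
Qed.

Lemma Rintegral_sqr_dotp_RV t : \int[P]_w (dotp t (X w) ^+ 2) = dotp t t.
Proof.
rewrite -sqr_enorm /Rintegral; under eq_integral do rewrite dotpC.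
by have := Xiso t; rewrite unlock => ->.
Qed.

Lemma integrable_of_sqr (f : T -> R) : measurable_fun setT f ->
  P.-integrable setT (EFin \o (fun w => f w ^+ 2)) -> P.-integrable setT (EFin \o f).
Proof.
move=> mf if2; apply: (le_Rintegrable mf (g := fun w => 1 + f w ^+ 2)).
  by move=> w; rewrite ler_norml; apply/andP; split; nra.
have i1 : P.-integrable setT (EFin \o cst (1 : R)).
  by apply: (integrable_bounded P (M := 1)) => // w; rewrite normr1.
by have := integrableD measurableT i1 if2; apply: eq_integrable.
Qed.

Lemma integrable_dotp_RV t : P.-integrable setT (EFin \o (fun w => dotp t (X w))).
Proof.
by apply: integrable_of_sqr; [exact: measurable_dotp_RV|exact: integrable_sqr_dotp_RV].
Qed.

Lemma Rintegral_dotp_RV t : \int[P]_w dotp t (X w) = 0.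
Proof.
have iX i : P.-integrable setT (EFin \o (fun w => t ord0 i * X w ord0 i)).
  have := integrableZl measurableT (t ord0 i) (X0 i).1.
  by apply: eq_integrable.
rewrite /Rintegral; under eq_integral do rewrite /dotp -sumEFin.
rewrite integral_sum//= big1// => i _.
under eq_integral do rewrite EFinM.
rewrite integralZl//; last exact: (X0 i).1.
by have := (X0 i).2; rewrite unlock => ->; rewrite mule0.
Qed.

Lemma integrable_sqr_enorm_RV : P.-integrable setT (EFin \o (fun w => dotp (X w) (X w))).
Proof.
have iX (i : 'I_n) : P.-integrable setT (EFin \o (fun w => X w ord0 i * X w ord0 i)).
  have := integrable_sqr_dotp_RV (delta_mx ord0 i); apply: eq_integrable => // w _ /=.
  rewrite -expr2 /dotp (bigD1 i)//= big1 => [|j ji]; rewrite mxE eqxx /=.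
    by rewrite eqxx mul1r addr0.
  by rewrite (negbTE ji) mul0r.
have := integrable_sum measurableT (index_enum 'I_n) (P := xpredT) (fun i _ => iX i).
by apply: eq_integrable => // w _; rewrite /= sumEFin.
Qed.

Lemma integrable_trig_rem t : P.-integrable setT (EFin \o (fun w => trig_rem (dotp t (X w)))).
Proof.
apply: le_Rintegrable (integrable_sqr_dotp_RV t).
  by apply: measurableT_comp (measurable_dotp_RV mX t); exact: measurable_trig_rem.
by move=> w; rewrite ger0_norm ?trig_rem_ge0// (trig_rem_le _).1.
Qed.

(** By E<t,X> = 0 and E<t,X>^2 = |t|^2, the Taylor polynomial of exp(i<t,X>) has expectation 1 -
    |t|^2/2. *)
Lemma cf_expansion_le t :
  `|re_cf P X t - 1 + dotp t t / 2| + `|im_cf P X t| <= \int[P]_w trig_rem (dotp t (X w)).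
Proof.
have i1 : P.-integrable setT (EFin \o cst (1 : R)).
  by apply: (integrable_bounded P (M := 1)) => // w; rewrite normr1.
have ic := integrable_cos_dotp_RV P mX t.
have isn := integrable_sin_dotp_RV P mX t.
have ih : P.-integrable setT (EFin \o (fun w => dotp t (X w) ^+ 2 / 2)).
  have := integrableZr measurableT (2^-1) (integrable_sqr_dotp_RV t).
  by apply: eq_integrable.
have ic1 : P.-integrable setT (EFin \o (fun w => cos (dotp t (X w)) - 1)).
  by have := integrableB measurableT ic i1; apply: eq_integrable.
have ia : P.-integrable setT (EFin \o (fun w => cos (dotp t (X w)) - 1 + dotp t (X w) ^+ 2 / 2)).
  by have := integrableD measurableT ic1 ih; apply: eq_integrable.
have ib : P.-integrable setT (EFin \o (fun w => sin (dotp t (X w)) - dotp t (X w))).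
  by have := integrableB measurableT isn (integrable_dotp_RV t); apply: eq_integrable.
have -> : re_cf P X t - 1 + dotp t t / 2 =
    \int[P]_w (cos (dotp t (X w)) - 1 + dotp t (X w) ^+ 2 / 2).
  rewrite RintegralD// RintegralB// Rintegral_probability_cst RintegralZr//.
    by rewrite Rintegral_sqr_dotp_RV.
  exact: integrable_sqr_dotp_RV.
have -> : im_cf P X t = \int[P]_w (sin (dotp t (X w)) - dotp t (X w)).
  by rewrite RintegralB//; [rewrite Rintegral_dotp_RV subr0|exact: integrable_dotp_RV].
rewrite [leRHS]RintegralD//; [|exact: (integrable_norm ia)|exact: (integrable_norm ib)].
by apply: lerD; exact: le_normr_Rintegral.
Qed.

Lemma measurable_enorm_RV : measurable_fun setT (fun w => enorm (X w)).
Proof.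
have msqrt : measurable_fun setT (@Num.sqrt R).
  by apply: continuous_measurable_fun; exact: sqrt_continuous.
exact: (measurableT_comp msqrt (measurable_dotp mX mX)).
Qed.

Lemma integrable_enorm_RV : P.-integrable setT (EFin \o (fun w => enorm (X w))).
Proof.
apply: integrable_of_sqr; first exact: measurable_enorm_RV.
by under [X in EFin \o X]eq_fun do rewrite sqr_enorm; exact: integrable_sqr_enorm_RV.
Qed.

(* Dominated convergence, with bound [|X|^2]: [trig_rem u <= u^2 min(1, |u|)] and
   [|<t, X>| <= |t| |X|]. *)
Lemma Rintegral_trig_rem_small e : 0 < e ->
  exists2 delta, 0 < delta & forall t, enorm t <= delta ->
    \int[P]_w trig_rem (dotp t (X w)) <= e * dotp t t.
Proof.
move=> e0.
pose h k w := dotp (X w) (X w) * Num.min 1 (enorm (X w) * k.+1%:R^-1).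
have menorm := measurable_enorm_RV.
have mh k : measurable_fun setT (h k).
  apply: measurable_funM; first exact: measurable_dotp.
  by apply: measurable_minr => //; exact: measurable_funM.
have min01 k w : 0 <= Num.min 1 (enorm (X w) * k.+1%:R^-1) <= 1.
  by rewrite le_min ler01 /= mulr_ge0 ?enorm_ge0// ge_min lexx.
have h_le k w : `|h k w| <= dotp (X w) (X w).
  have /andP[m0 m1] := min01 k w.
  by rewrite ger0_norm ?mulr_ge0 ?dotp_ge0// ler_piMr// dotp_ge0.
have ih k : P.-integrable setT (EFin \o h k).
  exact: le_Rintegrable (mh k) (h_le k) integrable_sqr_enorm_RV.
have h0 : \int[P]_w h k w @[k --> \oo] --> (0 : R).
  rewrite -[X in _ --> X](Rintegral_probability_cst P).
  apply: (Rintegral_dominated_cvg mh _ integrable_sqr_enorm_RV h_le) => w.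
  apply: norm_cvg0; apply: (@squeeze_cvgr _ _ _ _ (cst 0)
    (fun k => dotp (X w) (X w) * enorm (X w) * k.+1%:R^-1)).
  - apply: nearW => k; rewrite normr_ge0 /= ger0_norm; last first.
      by rewrite mulr_ge0 ?dotp_ge0//; case/andP: (min01 k w).
    by rewrite -mulrA ler_wpM2l ?dotp_ge0// ge_min lexx orbT.
  - exact: cvg_cst.
  - rewrite -[X in _ --> X](mulr0 (dotp (X w) (X w) * enorm (X w))).
    by apply: cvgMr; exact: cvg_harmonic.
have [k _ hk] : \forall k \near \oo, \int[P]_w h k w < e.
  exact: (cvgr_lt _ h0).
exists k.+1%:R^-1; first by rewrite invr_gt0.
move=> t tk; apply: (@le_trans _ _ (\int[P]_w (dotp t t * h k w))); last first.
  rewrite RintegralZl// mulrC ler_wpM2r ?dotp_ge0//.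
  by apply: ltW; apply: hk => /=.
apply: le_Rintegral => //.
- exact: integrable_trig_rem.
- by have := integrableZl measurableT (dotp t t) (ih k); apply: eq_integrable.
move=> w _; have cs := Cauchy_Schwarz_dotp t (X w).
have sq : dotp t (X w) ^+ 2 <= dotp t t * dotp (X w) (X w).
  by rewrite -real_normK ?num_real// -!sqr_enorm -exprMn lerXn2r ?nnegrE ?mulr_ge0 ?enorm_ge0.
have [r2 r3] := trig_rem_le (dotp t (X w)).
rewrite /h minr_pMr ?dotp_ge0// mulr1 minr_pMr ?dotp_ge0// le_min.
rewrite (le_trans r2 sq) /=; apply: (le_trans r3).
apply: (@le_trans _ _ (`|dotp t (X w)| ^+ 3)).
  by rewrite ler_pdivrMr// ler_peMr ?exprn_ge0// ler1n.
rewrite exprSr real_normK ?num_real// mulrA; apply: ler_pM => //; first exact: sqr_ge0.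
apply: (le_trans cs); rewrite mulrC ler_wpM2l ?enorm_ge0//.
Qed.

End moments.

(** A real-valued modulus: the norm on [R[i]] takes its values in [R[i]]. *)
Notation cmod := Normc.normc.

Section complex_modulus.
Context (R : realType).
Implicit Types z : R[i].

Lemma cmodE (a b : R) : cmod (Complex a b) = Num.sqrt (a ^+ 2 + b ^+ 2).
Proof. by []. Qed.

Lemma cmod_ge0 z : 0 <= cmod z.
Proof. by case: z => a b; rewrite cmodE sqrtr_ge0. Qed.

Lemma cmod_ge_Re (a b : R) : `|a| <= cmod (Complex a b).
Proof. by rewrite cmodE -sqrtr_sqr ler_wsqrtr// lerDl sqr_ge0. Qed.

Lemma cmod_ge_Im (a b : R) : `|b| <= cmod (Complex a b).
Proof. by rewrite cmodE -sqrtr_sqr ler_wsqrtr// lerDr sqr_ge0. Qed.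

Lemma cmod_le_abs (a b : R) : cmod (Complex a b) <= `|a| + `|b|.
Proof.
rewrite cmodE -[leRHS]ger0_norm ?addr_ge0// -sqrtr_sqr ler_wsqrtr//.
rewrite sqrrD !real_normK ?num_real// lerD2r lerDl.
by rewrite mulrn_wge0// mulr_ge0.
Qed.

Lemma cmod_triangle z z' : cmod (z + z') <= cmod z + cmod z'.
Proof. exact: le_normcD. Qed.

Lemma cmodX z k : cmod (z ^+ k) = cmod z ^+ k.
Proof.
elim: k => [|k IH]; last by rewrite !exprS Normc.normcM IH.
by rewrite !expr0 Normc.normc1.
Qed.

(** Telescoping in the unit disc. The loss of a factor k is affordable because the bases to be
    compared differ by o(1/k). *)
Lemma cmod_exprB_le z z' k : cmod z <= 1 -> cmod z' <= 1 ->
  cmod (z ^+ k - z' ^+ k) <= k%:R * cmod (z - z').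
Proof.
move=> z1 z'1; elim: k => [|k IH]; first by rewrite !expr0 subrr Normc.normc0 mul0r.
rewrite (_ : z ^+ k.+1 - z' ^+ k.+1 = z * (z ^+ k - z' ^+ k) + (z - z') * z' ^+ k); last first.
  by rewrite !exprS; ring.
apply: (le_trans (cmod_triangle _ _)); rewrite !Normc.normcM -natr1 mulrDl mul1r.
apply: lerD.
  by apply: le_trans IH; rewrite ler_piMl ?cmod_ge0.
by rewrite ler_piMr ?cmod_ge0// cmodX exprn_ile1 ?cmod_ge0.
Qed.

Lemma cmod_real (a : R) : cmod (Complex a 0) = `|a|.
Proof. by rewrite cmodE expr0n addr0 sqrtr_sqr. Qed.

End complex_modulus.

(* [char_fun] of a function that need not be packaged as a random variable. *)
Definition cf d (T : measurableType d) (R : realType) (P : probability T R) (n : nat)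
  (Z : T -> 'rV[R]_n) (t : 'rV[R]_n) : R[i] := Complex (re_cf P Z t) (im_cf P Z t).

Section cf_facts.
Context d (T : measurableType d) (R : realType) (P : probability T R) (n : nat).

(** The variance is nonnegative: integrate (f - a)^2, with [a] the mean. *)
Lemma sqr_Rintegral_le (f : T -> R) (M : R) : measurable_fun setT f -> (forall w, `|f w| <= M) ->
  (\int[P]_w f w) ^+ 2 <= \int[P]_w (f w ^+ 2).
Proof.
move=> mf fM; have if1 := integrable_bounded P mf fM.
have if2 : P.-integrable setT (EFin \o (fun w => f w ^+ 2)).
  apply: (integrable_bounded P (M := M ^+ 2)); first exact: measurable_funX.
  by move=> w; rewrite normrX lerXn2r ?nnegrE// (le_trans _ (fM w)).
set a := \int[P]_w f w.
have i3 : P.-integrable setT (EFin \o (fun w => - (2 * a) * f w)).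
  by have := integrableZl measurableT (- (2 * a)) if1; apply: eq_integrable.
have i4 : P.-integrable setT (EFin \o cst (a ^+ 2)).
  exact: (integrable_bounded P (M := `|a ^+ 2|)).
have i34 : P.-integrable setT (EFin \o (fun w => - (2 * a) * f w + a ^+ 2)).
  by have := integrableD measurableT i3 i4; apply: eq_integrable.
have : 0 <= \int[P]_w (f w ^+ 2 + (- (2 * a) * f w + a ^+ 2)).
  apply: Rintegral_ge0 => w _; have := sqr_ge0 (f w - a); rewrite sqrrB; lra.
rewrite RintegralD// RintegralD// RintegralZl// Rintegral_probability_cst -/a; lra.
Qed.

(** Jensen's inequality for the cosine and the sine separately, followed by cos^2 + sin^2 = 1. *)
Lemma cmod_cf_le1 (Z : T -> 'rV[R]_n) t : measurable_fun setT Z -> cmod (cf P Z t) <= 1.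
Proof.
move=> mZ; have mc := measurable_cos_dotp_RV mZ t; have ms := measurable_sin_dotp_RV mZ t.
rewrite cmodE -sqrtr1 ler_wsqrtr//.
have c2 := sqr_Rintegral_le mc (fun w => cos_abs_le1 _).
have s2 := sqr_Rintegral_le ms (fun w => sin_abs_le1 _).
apply: (le_trans (lerD c2 s2)); rewrite -RintegralD//.
- under eq_Rintegral do rewrite cos2Dsin2.
  by rewrite Rintegral_probability_cst.
- apply: (integrable_bounded P (M := 1)); first exact: measurable_funX.
  by move=> w; rewrite normrX exprn_ile1// cos_abs_le1.
- apply: (integrable_bounded P (M := 1)); first exact: measurable_funX.
  by move=> w; rewrite normrX exprn_ile1// sin_abs_le1.
Qed.

Lemma cf_scale (Z : T -> 'rV[R]_n) (c : R) t : cf P (fun w => c *: Z w) t = cf P Z (c *: t).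
Proof. by congr Complex; apply: eq_Rintegral => w _; rewrite dotpZr dotpZl. Qed.

Lemma cf_shifted_sum (Xs : nat -> {RV P >-> 'rV[R]_n}) (Y : {RV P >-> 'rV[R]_n}) k t :
  mutually_independent Xs -> independent_of_seq Y Xs ->
  cf P (shifted_sum Xs Y k) t = cf P Y t * \prod_(j < k) cf P (Xs j) t.
Proof.
move=> iX iY; elim: k => [|k IH].
  rewrite big_ord0 mulr1 (_ : shifted_sum Xs Y 0 = Y)//.
  by apply/funext => w; rewrite /shifted_sum big_ord0 addr0.
have mS := measurable_shifted_sum Xs Y k.
have mX : measurable_fun setT (Xs k) by exact: measurable_funPT.
rewrite big_ord_recr /= mulrA -IH shifted_sumS.
pose S : {RV P >-> 'rV[R]_n} := HB.pack (shifted_sum Xs Y k) (isMeasurableFun.Build _ _ _ _ _ mS).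
have UV A B : measurable A -> measurable B ->
    P (S @^-1` A `&` Xs k @^-1` B) = (P (S @^-1` A) * P (Xs k @^-1` B))%E.
  exact: indep_shifted_sum.
have dotp_cst : measurable_fun setT (fun x : 'rV[R]_n => dotp t x).
  by apply: measurable_dotp; [exact: measurable_cst|exact: measurable_id].
have mcos : measurable_fun setT (fun x : 'rV[R]_n => cos (dotp t x)).
  exact: measurableT_comp (@measurable_cos R) dotp_cst.
have msin : measurable_fun setT (fun x : 'rV[R]_n => sin (dotp t x)).
  exact: measurableT_comp (@measurable_sin R) dotp_cst.
have cb (x : 'rV[R]_n) : `|cos (dotp t x)| <= 1 by exact: cos_abs_le1.
have sb (x : 'rV[R]_n) : `|sin (dotp t x)| <= 1 by exact: sin_abs_le1.
have ib (g h : 'rV[R]_n -> R) : measurable_fun setT g -> measurable_fun setT h ->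
    (forall x, `|g x| <= 1) -> (forall x, `|h x| <= 1) ->
    P.-integrable setT (EFin \o (fun w => g (S w) * h (Xs k w))).
  move=> mg mh g1 h1; apply: (integrable_bounded P (M := 1)).
    by apply: measurable_funM; exact: measurableT_comp.
  by move=> w; rewrite normrM -[leRHS]mulr1 ler_pM.
rewrite /cf; simpc; congr Complex.
- rewrite -(Rintegral_indep UV mcos mcos cb cb) -(Rintegral_indep UV msin msin sb sb).
  rewrite -RintegralB//; [|exact: (ib _ _ mcos mcos cb cb)|exact: (ib _ _ msin msin sb sb)].
  by apply: eq_Rintegral => w _; rewrite dotpDr cosD.
- rewrite -(Rintegral_indep UV mcos msin cb sb) -(Rintegral_indep UV msin mcos sb cb).
  rewrite -RintegralD//; [|exact: (ib _ _ mcos msin cb sb)|exact: (ib _ _ msin mcos sb cb)].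
  by apply: eq_Rintegral => w _; rewrite dotpDr sinD addrC.
Qed.

End cf_facts.

Lemma cf_same_law d d' (T : measurableType d) (T' : measurableType d') (R : realType)
    (P : probability T R) (P' : probability T' R) (n : nat)
    (Y : {RV P >-> 'rV[R]_n}) (Y' : {RV P' >-> 'rV[R]_n}) t :
  same_law Y Y' -> cf P Y t = cf P' Y' t.
Proof.
move=> YY'.
have dotp_cst : measurable_fun setT (fun x : 'rV[R]_n => dotp t x).
  by apply: measurable_dotp; [exact: measurable_cst|exact: measurable_id].
have key (g : R -> R) : measurable_fun setT g -> (forall x, `|g x| <= 1) ->
    \int[P]_w g (dotp t (Y w)) = \int[P']_w g (dotp t (Y' w)).
  move=> mg g1; have mgt : measurable_fun setT (EFin \o (fun x : 'rV[R]_n => g (dotp t x))).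
    by apply/measurable_EFinP; exact: measurableT_comp mg dotp_cst.
  rewrite /Rintegral; congr fine.
  have := integral_distribution (X := Y) mgt; rewrite /comp => <-; last first.
    apply: (integrable_bounded P (M := 1)) => //.
    by apply: (measurableT_comp mg); apply: measurable_dotp_RV; exact: measurable_funPT.
  have := integral_distribution (X := Y') mgt; rewrite /comp => <-; last first.
    apply: (integrable_bounded P' (M := 1)) => //.
    by apply: (measurableT_comp mg); apply: measurable_dotp_RV; exact: measurable_funPT.
  by apply: eq_measure_integral => A mA _; exact: YY'.
congr Complex; apply: key => //; [exact: measurable_cos|exact: cos_abs_le1
  |exact: measurable_sin|exact: sin_abs_le1].
Qed.

(** * Gaussian decay of the characteristic function *)

Section enorm_topology.
Context (R : realType) (n : nat).
Implicit Types u v t : 'rV[R]_n.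

Lemma enormD u v : enorm (u + v) <= enorm u + enorm v.
Proof.
rewrite -[leRHS]ger0_norm ?addr_ge0 ?enorm_ge0// -sqrtr_sqr ler_wsqrtr//.
rewrite dotpDl !dotpDr (dotpC v u) sqrrD !sqr_enorm.
have := Cauchy_Schwarz_dotp u v; have := ler_norm (dotp u v); lra.
Qed.

Lemma enormN u : enorm (- u) = enorm u.
Proof. by rewrite -scaleN1r enormZ normrN1 mul1r. Qed.

Lemma continuous_enorm : continuous (@enorm R n).
Proof.
apply: (@Lipschitz_enorm_continuous _ _ _ 1) => x y; rewrite mul1r ler_norml.
have := enormD (x - y) y; have := enormD (y - x) x; rewrite !subrK -(opprB x y) enormN.
by move=> *; apply/andP; split; lra.
Qed.

Lemma compact_annulus (a b : R) : compact [set t : 'rV[R]_n | a <= enorm t <= b].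
Proof.
apply: bounded_closed_compact.
  exists b; split; first exact: num_real.
  move=> M bM t /= /andP[_ tb]; apply: ltW; apply: le_lt_trans bM.
  rewrite /Num.norm /= mx_normrE; apply: bigmax_le => [|[i j] _ /=].
    exact: le_trans (enorm_ge0 t) tb.
  by rewrite (ord1 i); exact: le_trans (abs_coord_le_enorm t j) tb.
rewrite (_ : [set t | _] = @enorm R n @^-1` `[a, b]); last first.
  by apply/seteqP; split => t /=; rewrite in_itv.
apply: closed_comp => //; last exact: interval_closed.
by move=> t _; exact: continuous_enorm.
Qed.

End enorm_topology.

Definition cf_decay d (T : measurableType d) (R : realType) (P : probability T R) (n : nat)
    (X : T -> 'rV[R]_n) (r c : R) : Prop :=
  forall t, enorm t <= r -> cmod (cf P X t) <= expR (- (c * dotp t t)).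

Section decay.
Context d (T : measurableType d) (R : realType) (P : probability T R) (n : nat).
Variable X : {RV P >-> 'rV[R]_n}.
Hypothesis X0 : mean_zero X.
Hypothesis Xiso : isotropic X.

Let mX : measurable_fun setT X. Proof. exact: measurable_funPT. Qed.

(** |t|^2 <= 2 keeps 1 - |t|^2/2 nonnegative, so |f1(t)| <= 1 - |t|^2/2 + a |t|^2, and 1 - x <=
    exp(-x). *)
Lemma cmod_cf_le_expR a t : dotp t t <= 2 ->
  \int[P]_w trig_rem (dotp t (X w)) <= a * dotp t t ->
  cmod (cf P X t) <= expR (- ((1 / 2 - a) * dotp t t)).
Proof.
move=> t2 ta; apply: (le_trans (cmod_le_abs _ _)).
have := cf_expansion_le X0 Xiso t; set C := re_cf P X t; set S := im_cf P X t => CS.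
have C_le : `|C| <= `|C - 1 + dotp t t / 2| + (1 - dotp t t / 2).
  have {1}-> : C = (C - 1 + dotp t t / 2) + (1 - dotp t t / 2) by ring.
  apply: (le_trans (ler_normD _ _)); rewrite lerD2l ger0_norm//; lra.
apply: le_trans (expR_ge1Dx _); lra.
Qed.

Lemma cf_decay_exists : exists2 r, 0 < r & cf_decay P X r (1 / 4).
Proof.
have e0 : 0 < 1 / 4 :> R by lra.
have [delta d0 small] := Rintegral_trig_rem_small Xiso e0.
exists (Num.min delta 1); first by rewrite lt_min d0 ltr01.
move=> t; rewrite le_min => /andP[td t1].
have -> : 1 / 4 = 1 / 2 - 1 / 4 :> R by lra.
apply: cmod_cf_le_expR (small t td).
by rewrite -sqr_enorm (@le_trans _ _ 1) ?ler1n// exprn_ile1// enorm_ge0.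
Qed.

Lemma exists_unit_vector : (0 < n)%N -> exists u : 'rV[R]_n, enorm u = 1.
Proof.
move=> n0; exists (delta_mx ord0 (Ordinal n0)).
rewrite /enorm /dotp (bigD1 (Ordinal n0))//= big1 => [|j ji]; rewrite !mxE eqxx /=.
  by rewrite ?eqxx mulr1 addr0 sqrtr1.
by rewrite (negbTE ji) mul0r.
Qed.

Lemma beta3_bound : (beta3 X < +oo)%E -> forall u : 'rV[R]_n, enorm u = 1 ->
  P.-integrable setT (EFin \o (fun w => `|dotp u (X w)| ^+ 3)) /\
  \int[P]_w (`|dotp u (X w)| ^+ 3) <= fine (beta3 X).
Proof.
move=> bfin u u1.
have ub : ('E_P[fun w => (`|dotp (X w) u| ^+ 3)%R] <= beta3 X)%E.
  by apply: ereal_sup_ubound; exists u.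
have E : ('E_P[fun w => (`|dotp (X w) u| ^+ 3)%R] = \int[P]_w (`|dotp u (X w)| ^+ 3)%:E)%E.
  by rewrite unlock; apply: eq_integral => w _; rewrite dotpC.
rewrite E in ub.
have m3 : measurable_fun setT (fun w => `|dotp u (X w)| ^+ 3).
  apply: measurable_funX; apply: measurableT_comp => //; exact: measurable_dotp_RV.
have b0 : (0 <= beta3 X)%E.
  by apply: le_trans ub; apply: integral_ge0 => w _; rewrite lee_fin exprn_ge0.
have i3 : P.-integrable setT (EFin \o (fun w => `|dotp u (X w)| ^+ 3)).
  apply/integrableP; split; first exact/measurable_EFinP.
  under eq_integral do rewrite /= ger0_norm ?exprn_ge0//.
  exact: le_lt_trans ub bfin.
split=> //; rewrite /Rintegral; apply: fine_le => //.
  exact: integrable_fin_num.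
by rewrite ge0_fin_numE.
Qed.

(** This puts the ball of radius 1/beta3 inside the unit ball. Instead of Lyapunov's inequality, x^3
    >= 3/2 x^2 - 1/2 is integrated with E x^2 = 1: the right side is the tangent at 1 of the 3/2
    power of x^2, and the difference is (x - 1)^2 (x + 1/2). *)
Lemma beta3_ge1 : (0 < n)%N -> (beta3 X < +oo)%E -> 1 <= fine (beta3 X).
Proof.
move=> n0 bfin; have [u u1] := exists_unit_vector n0.
have [i3 b3] := beta3_bound bfin u1; apply: le_trans b3.
have E2 := Rintegral_sqr_dotp_RV Xiso u.
have i2 := integrable_sqr_dotp_RV Xiso u.
have i1 : P.-integrable setT (EFin \o (fun w => 3 / 2 * dotp u (X w) ^+ 2 - 1 / 2)).
  have ic : P.-integrable setT (EFin \o cst (1 / 2 : R)).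
    exact: (integrable_bounded P (M := `|1 / 2|)).
  by have := integrableB measurableT (integrableZl measurableT (3 / 2) i2) ic; apply: eq_integrable.
have -> : 1 = \int[P]_w (3 / 2 * dotp u (X w) ^+ 2 - 1 / 2).
  rewrite RintegralB//; last 2 first.
  - by have := integrableZl measurableT (3 / 2) i2; apply: eq_integrable.
  - exact: (integrable_bounded P (M := `|1 / 2|)).
  by rewrite RintegralZl// Rintegral_probability_cst E2 -sqr_enorm u1 expr1n; lra.
apply: le_Rintegral => // w _.
rewrite -[dotp u (X w) ^+ 2]real_normK ?num_real//.
set x := `|dotp u (X w)|; have x0 : 0 <= x by exact: normr_ge0.
have : 0 <= (x - 1) ^+ 2 * (x + 1 / 2) by rewrite mulr_ge0 ?sqr_ge0//; lra.
have -> : (x - 1) ^+ 2 * (x + 1 / 2) = x ^+ 3 - 3 / 2 * x ^+ 2 + 1 / 2 by field.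
lra.
Qed.

Lemma cf_decay_beta3 : (0 < n)%N -> (beta3 X < +oo)%E ->
  cf_decay P X (fine (beta3 X))^-1 (1 / 6).
Proof.
move=> n0 bfin t tb; have b1 := beta3_ge1 n0 bfin; set b := fine (beta3 X) in tb b1 *.
have b0 : 0 < b by exact: lt_le_trans b1.
have -> : 1 / 6 = 1 / 2 - 1 / 3 :> R by lra.
have t1 : enorm t <= 1 by apply: (le_trans tb); rewrite invf_le1.
apply: cmod_cf_le_expR.
  by rewrite -sqr_enorm (@le_trans _ _ 1) ?ler1n// exprn_ile1// enorm_ge0.
(* The vector t = 0 has no direction to which [beta3_bound] could be applied. *)
have [t0|t0] := eqVneq (enorm t) 0.
  rewrite (enorm_eq0 t0) dotp0l mulr0; under eq_Rintegral do rewrite dotp0l.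
  rewrite /trig_rem cos0 sin0 subrr expr0n mul0r addr0 subr0 normr0 addr0.
  by rewrite Rintegral_probability_cst.
pose u := (enorm t)^-1 *: t.
have u1 : enorm u = 1 by rewrite enormZ ger0_norm ?invr_ge0 ?enorm_ge0// mulVf.
have tu w : dotp t (X w) = enorm t * dotp u (X w) by rewrite dotpZl mulrA divff// mul1r.
have [i3 b3] := beta3_bound bfin u1.
apply: (@le_trans _ _ (\int[P]_w (enorm t ^+ 3 / 3 * `|dotp u (X w)| ^+ 3))).
  apply: le_Rintegral => //.
  - exact: integrable_trig_rem.
  - by have := integrableZl measurableT (enorm t ^+ 3 / 3) i3; apply: eq_integrable.
  move=> w _; apply: (le_trans (trig_rem_le _).2).
  by rewrite tu normrM exprMn (ger0_norm (enorm_ge0 _)) mulrAC.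
rewrite RintegralZl// -sqr_enorm.
apply: (@le_trans _ _ (enorm t ^+ 3 / 3 * b)).
  by rewrite ler_wpM2l// divr_ge0// exprn_ge0// enorm_ge0.
have -> : enorm t ^+ 3 / 3 * b = 1 / 3 * enorm t ^+ 2 * (enorm t * b) by field.
rewrite ler_piMr//; first by rewrite mulr_ge0 ?sqr_ge0.
by rewrite -ler_pdivlMr// mul1r.
Qed.

(** Lipschitz in t with constant E|X|, finite by isotropy. *)
Lemma continuous_trig_cf (g : R -> R) : measurable_fun setT g -> (forall x, `|g x| <= 1) ->
  (forall x y, `|g x - g y| <= `|x - y|) ->
  continuous (fun t : 'rV[R]_n => \int[P]_w g (dotp t (X w))).
Proof.
move=> mg g1 gL; apply: (@Lipschitz_enorm_continuous _ _ _ (\int[P]_w enorm (X w))) => s t.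
have ig r : P.-integrable setT (EFin \o (fun w => g (dotp r (X w)))).
  apply: (integrable_bounded P (M := 1)) => //.
  by apply: measurableT_comp => //; exact: measurable_dotp_RV.
have iB := integrableB measurableT (ig s) (ig t).
rewrite -RintegralB//; apply: (le_trans (le_normr_Rintegral measurableT iB)).
rewrite -RintegralZr//; last exact: integrable_enorm_RV.
apply: le_Rintegral => //.
- exact: (integrable_norm iB).
- have := integrableZr measurableT (enorm (s - t)) (integrable_enorm_RV Xiso).
  by apply: eq_integrable.
move=> w _; apply: (le_trans (gL _ _)).
by rewrite -dotpBl (le_trans (Cauchy_Schwarz_dotp _ _))// mulrC.
Qed.

Lemma continuous_cmod_cf : continuous (fun t : 'rV[R]_n => cmod (cf P X t)).
Proof.
have cC : continuous (re_cf P X).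
  apply: continuous_trig_cf; [exact: measurable_cos|exact: cos_abs_le1|exact: cos_Lipschitz].
have cS : continuous (im_cf P X).
  apply: continuous_trig_cf; [exact: measurable_sin|exact: sin_abs_le1|exact: sin_Lipschitz].
move=> t; apply: (@continuous_comp _ _ _
  (fun t : 'rV[R]_n => re_cf P X t * re_cf P X t + im_cf P X t * im_cf P X t) Num.sqrt).
  apply: (@cvgD R R _ (nbhs t) _
    (fun t => re_cf P X t * re_cf P X t) (fun t => im_cf P X t * im_cf P X t)).
    exact: cvgM (cC t) (cC t).
  exact: cvgM (cS t) (cS t).
exact: sqrt_continuous.
Qed.

Lemma cf_decay_nonlattice r : 0 < r -> nonlattice X -> exists2 c, 0 < c & cf_decay P X r c.
Proof.
move=> r0 Xnl; have [delta d0 dec] := cf_decay_exists.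
have lt1 t : t != 0 -> cmod (cf P X t) < 1.
  by move=> /Xnl; rewrite -ltcR; apply: le_lt_trans.
pose K := [set t : 'rV[R]_n | delta <= enorm t <= r].
(* q must be positive for its logarithm to be used, which the maximum with 1/2 ensures; the value
   1/2 alone serves an empty annulus. *)
have [q [q0 q1 Kq]] : exists q, [/\ 0 < q, q < 1 & forall t, K t -> cmod (cf P X t) <= q].
  have [K0|/set0P K0] := eqVneq K set0.
    by exists (1 / 2); split; [lra|lra|move=> t; rewrite K0].
  have [|t /set_mem Kt tmax] := compact_EVT_max K0 (@compact_annulus R n delta r)
      (f := fun t => cmod (cf P X t)).
    by apply: continuous_subspaceT; exact: continuous_cmod_cf.
  exists (Num.max (1 / 2) (cmod (cf P X t))); split.
  - by rewrite lt_max; apply/orP; left; lra.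
  - rewrite gt_max; apply/andP; split; first lra.
    apply: lt1; apply: contraTneq d0 => t0; move: Kt => /andP[].
    by rewrite t0 enorm0 leNgt => ->.
  - by move=> s Ks; rewrite le_max tmax ?orbT// inE.
(* Solves exp(-c1 r^2) = q, so the Gaussian stays above q on the whole ball of radius r. *)
pose c1 := - ln q / r ^+ 2.
have c10 : 0 < c1 by rewrite divr_gt0 ?exprn_gt0// oppr_gt0 ln_lt0// q0 q1.
exists (Num.min (1 / 4) c1); first by rewrite lt_min c10 andbT; lra.
move=> t tr; have [td|dt] := leP (enorm t) delta.
  apply: (le_trans (dec t td)); rewrite ler_expR lerN2 ler_wpM2r ?dotp_ge0//.
  by rewrite ge_min lexx.
apply: (@le_trans _ _ q); first by apply: Kq; rewrite /K /= (ltW dt).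
rewrite -[X in X <= _]lnK ?posrE// ler_expR lerNr.
apply: (@le_trans _ _ (c1 * dotp t t)); first by rewrite ler_wpM2r ?dotp_ge0// ge_min lexx orbT.
apply: (@le_trans _ _ (c1 * r ^+ 2)); last by rewrite divfK ?gt_eqF// exprn_gt0.
by rewrite ler_wpM2l ?(ltW c10)// -sqr_enorm lerXn2r ?nnegrE ?enorm_ge0// ltW.
Qed.

End decay.

(** * The local limit theorem *)

(** The upper bound comes from multiplying by 1 + u: exp(-u)(1 + u) <= 1 <= 1 + u^3 = (1 - u +
    u^2)(1 + u). *)
Lemma expRN_quadratic_le (R : realType) (u : R) : 0 <= u -> `|expR (- u) - 1 + u| <= u ^+ 2.
Proof.
move=> u0; have h1 := expR_ge1Dx (- u).
have h2 : expR (- u) * (1 + u) <= 1.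
  by rewrite -[leRHS](expRxMexpNx_1 u) mulrC ler_wpM2r ?expR_ge0// expR_ge1Dx.
have h3 : 0 <= (1 - u + u ^+ 2 - expR (- u)) * (1 + u).
  have -> : (1 - u + u ^+ 2 - expR (- u)) * (1 + u) = 1 + u ^+ 3 - expR (- u) * (1 + u) by ring.
  have : 0 <= u ^+ 3 by rewrite exprn_ge0.
  lra.
have u1 : 0 < 1 + u by lra.
have h4 : 0 <= 1 - u + u ^+ 2 - expR (- u) by move: h3; rewrite pmulr_lge0.
rewrite ger0_norm; lra.
Qed.

Section pointwise_limit.
Context d (T : measurableType d) (R : realType) (P : probability T R) (n : nat).
Variable X : {RV P >-> 'rV[R]_n}.

Let mX : measurable_fun setT X. Proof. exact: measurable_funPT. Qed.

(** Indexing by k + 1 keeps the square root away from 0; the shift is undone in the final limit. *)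
Let s k : R := (Num.sqrt k.+1%:R)^-1.

Let s_ge0 k : 0 <= s k. Proof. by rewrite invr_ge0 sqrtr_ge0. Qed.

Let sqr_s k : k.+1%:R * s k ^+ 2 = 1.
Proof. by rewrite exprVn sqr_sqrtr// divff// pnatr_eq0. Qed.

Lemma cvg_inv_sqrt : (Num.sqrt k.+1%:R)^-1 @[k --> \oo] --> (0 : R).
Proof.
have : Num.sqrt k.+1%:R^-1 @[k --> \oo] --> Num.sqrt (0 : R).
  apply: continuous_cvg; first exact: sqrt_continuous.
  exact: cvg_harmonic.
by rewrite sqrtr0; under eq_fun do rewrite sqrtrV//.
Qed.

(** Used for the smoothing vector [Y], of which no moments are assumed: hence bounded convergence
    rather than the expansion at 0. *)
Lemma cvg_cf_scaled t : cmod (cf P X ((Num.sqrt k.+1%:R)^-1 *: t) - 1) @[k --> \oo] --> (0 : R).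
Proof.
have key (g : R -> R) : measurable_fun setT g -> continuous g -> (forall x, `|g x| <= 1) ->
    \int[P]_w g (dotp (s k *: t) (X w)) @[k --> \oo] --> g 0.
  move=> mg cg g1; rewrite -[X in _ --> X](Rintegral_probability_cst P).
  apply: (@Rintegral_dominated_cvg _ _ _ _ _ _ (cst 1)) => [k|w||k w].
  - by apply: measurableT_comp => //; exact: measurable_dotp_RV.
  - apply: continuous_cvg; first exact: cg.
    rewrite (_ : (fun k => _) = (fun k => s k * dotp t (X w))).
      by rewrite -[X in _ --> X](mul0r (dotp t (X w))); apply: cvgMl; exact: cvg_inv_sqrt.
    by apply/funext => k; rewrite dotpZl.
  - by apply: (integrable_bounded P (M := 1)) => // w; rewrite normr1.
  - exact: g1.
have kc := key cos (@measurable_cos R) (@continuous_cos R) (@cos_abs_le1 R).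
have ks := key sin (@measurable_sin R) (@continuous_sin R) (@sin_abs_le1 R).
rewrite cos0 in kc; rewrite sin0 in ks.
apply: (@squeeze_cvgr _ _ _ _ (cst 0)
  (fun k => `|re_cf P X (s k *: t) - 1| + `|im_cf P X (s k *: t)|)).
- apply: nearW => k; apply/andP; split; first exact: cmod_ge0.
  rewrite -/(s k).
  rewrite -[im_cf P X (s k *: t)]subr0.
  exact: (cmod_le_abs (re_cf P X (s k *: t) - 1) (im_cf P X (s k *: t) - 0)).
- exact: cvg_cst.
- rewrite -[X in _ --> X]addr0; apply: cvgD.
    by rewrite -(normr0 R) -(subrr (1 : R)); apply: cvg_norm; apply: cvgB => //; exact: cvg_cst.
  by rewrite -(normr0 R); apply: cvg_norm.
Qed.

Hypothesis X0 : mean_zero X.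
Hypothesis Xiso : isotropic X.

(** Both terms are compared with 1 - |t|^2/2. *)
Lemma cmod_cf_expR_le t : cmod (cf P X t - Complex (expR (- (dotp t t / 2))) 0) <=
  \int[P]_w trig_rem (dotp t (X w)) + (dotp t t / 2) ^+ 2.
Proof.
have -> : cf P X t - Complex (expR (- (dotp t t / 2))) 0 =
    Complex (re_cf P X t - expR (- (dotp t t / 2))) (im_cf P X t).
  by rewrite /cf; simpc.
apply: (le_trans (cmod_le_abs _ _)).
have h := cf_expansion_le X0 Xiso t.
have h2 := @expRN_quadratic_le _ (dotp t t / 2) (divr_ge0 (dotp_ge0 t) (ler0n _ 2)).
have -> : re_cf P X t - expR (- (dotp t t / 2)) = (re_cf P X t - 1 + dotp t t / 2)
    - (expR (- (dotp t t / 2)) - 1 + dotp t t / 2) by ring.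
have := ler_normB (re_cf P X t - 1 + dotp t t / 2) (expR (- (dotp t t / 2)) - 1 + dotp t t / 2).
lra.
Qed.

(** The Gaussian is written as a (k+1)-th power and [cmod_exprB_le] applied. It remains that k + 1
    times the error of one factor vanishes, because that error is o(|t|^2/(k+1)). *)
Lemma cvg_cf_power t :
  cmod (cf P X ((Num.sqrt k.+1%:R)^-1 *: t) ^+ k.+1 - Complex (expR (- (dotp t t / 2))) 0)
    @[k --> \oo] --> (0 : R).
Proof.
pose rho k := k.+1%:R * \int[P]_w trig_rem (dotp (s k *: t) (X w)).
have dotps k : k.+1%:R * dotp (s k *: t) (s k *: t) = dotp t t.
  rewrite dotpZl dotpZr; transitivity (k.+1%:R * s k ^+ 2 * dotp t t); first by ring.
  by rewrite sqr_s mul1r.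
have rho0 : rho k @[k --> \oo] --> (0 : R).
  apply/cvgr0Pnorm_le => e e0.
  (* The summand 1 covers t = 0. *)
  have e'0 : 0 < e / (dotp t t + 1) by rewrite divr_gt0// ltr_wpDl ?dotp_ge0.
  have [delta d0 small] := Rintegral_trig_rem_small Xiso e'0.
  have : enorm t * s k @[k --> \oo] --> (0 : R).
    by rewrite -[X in _ --> X](mulr0 (enorm t)); apply: cvgMr; exact: cvg_inv_sqrt.
  move=> /cvgr_lt/(_ _ d0); apply: filterS => k sk.
  rewrite ger0_norm; last by rewrite mulr_ge0// Rintegral_ge0// => w _; exact: trig_rem_ge0.
  apply: (@le_trans _ _ (k.+1%:R * (e / (dotp t t + 1) * dotp (s k *: t) (s k *: t)))).
    rewrite ler_wpM2l//; apply: small.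
    by rewrite enormZ ger0_norm// mulrC ltW.
  rewrite mulrCA dotps mulrAC ler_pdivrMr ?ltr_wpDl ?dotp_ge0//.
  by rewrite ler_wpM2l ?(ltW e0)// lerDl.
(* The second term is k + 1 times the squared error (|t|^2 / (2(k + 1)))^2 of the exponential. *)
apply: (@squeeze_cvgr _ _ _ _ (cst 0) (fun k => rho k + dotp t t ^+ 2 / 4 * k.+1%:R^-1)).
- apply: nearW => k; apply/andP; split; first exact: cmod_ge0.
  rewrite -/(s k).
  set e := expR (- (dotp (s k *: t) (s k *: t) / 2)).
  have -> : Complex (expR (- (dotp t t / 2))) 0 = (Complex e 0) ^+ k.+1.
    rewrite -[Complex e 0]/(real_complex R e) -rmorphXn; congr Complex.
    by rewrite -expRM_natl -(dotps k); congr expR; ring.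
  apply: (le_trans (cmod_exprB_le _ _ _)).
  + exact: cmod_cf_le1.
  + rewrite cmod_real ger0_norm ?expR_ge0// -expR0 ler_expR oppr_le0.
    by rewrite divr_ge0 ?dotp_ge0.
  apply: (le_trans (ler_wpM2l (ler0n _ _) (cmod_cf_expR_le _))).
  rewrite mulrDr lerD2l; have k0 : k.+1%:R != 0 :> R by rewrite pnatr_eq0.
  have -> : dotp (s k *: t) (s k *: t) = dotp t t / k.+1%:R.
    by rewrite -(dotps k) mulrAC divff ?mul1r.
  by rewrite le_eqVlt; apply/orP; left; apply/eqP; field.
- exact: cvg_cst.
- rewrite -[X in _ --> X]addr0; apply: cvgD => //.
  rewrite -[X in _ --> X](mulr0 (dotp t t ^+ 2 / 4)); apply: cvgMr; exact: cvg_harmonic.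
Qed.

End pointwise_limit.

Section local_limit.
Context d d' (T : measurableType d) (T' : measurableType d') (R : realType).
Context (P : probability T R) (P' : probability T' R) (n : nat).
Variable X : {RV P >-> 'rV[R]_n}.
Variables (r c : R).
Hypothesis X0 : mean_zero X.
Hypothesis Xiso : isotropic X.
Hypothesis c0 : 0 < c.
Hypothesis Xdec : cf_decay P X r c.
Variables (Xs : nat -> {RV P' >-> 'rV[R]_n}) (Y : {RV P' >-> 'rV[R]_n}).
Hypothesis indepX : mutually_independent Xs.
Hypothesis lawX : forall k, same_law (Xs k) X.
Hypothesis indepY : independent_of_seq Y Xs.
Hypothesis Y0 : forall t : 'rV[R]_n, r < enorm t -> char_fun Y t = 0.
Notation lebn := (lebesgue_rV R n).

Let Z k := normalized_sum Y Xs k.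

Let mZ k : measurable_fun setT (Z k).
Proof.
have mS := measurable_shifted_sum Xs Y k.
apply: measurable_fun_rV => i.
rewrite (_ : (fun _ => _) = (fun w => (Num.sqrt k%:R)^-1 * shifted_sum Xs Y k w ord0 i)).
  by apply: measurable_funM => //; exact: (measurableT_comp (@measurable_coord R n i) mS).
by apply/funext => w; rewrite mxE.
Qed.

Let cfZ k t : cf P' (Z k) t =
  cf P' Y ((Num.sqrt k%:R)^-1 *: t) * cf P X ((Num.sqrt k%:R)^-1 *: t) ^+ k.
Proof.
rewrite (cf_scale P' (shifted_sum Xs Y k)) cf_shifted_sum//; congr (_ * _).
under eq_bigr do rewrite (cf_same_law _ (lawX _)).
by rewrite prodr_const card_ord.
Qed.

Let cfZ_out k t : (0 < k)%N -> r * Num.sqrt k%:R < enorm t -> cf P' (Z k) t = 0.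
Proof.
move=> k0 rt; rewrite cfZ (Y0 _ : cf P' Y _ = 0) ?mul0r//.
by rewrite enormZ ger0_norm ?invr_ge0 ?sqrtr_ge0// mulrC ltr_pdivlMr// sqrtr_gt0 ltr0n.
Qed.

Let supp k : (0 < k)%N -> forall t, r * Num.sqrt k%:R < enorm t ->
  re_cf P' (Z k) t = 0 /\ im_cf P' (Z k) t = 0.
Proof. by move=> k0 t /(cfZ_out k0) [-> ->]. Qed.

(** The Gaussian bound is invariant under scaling by 1/sqrt k followed by the k-th power; the factor
    coming from [Y] has modulus at most 1. *)
Let cfZ_le k t : (0 < k)%N -> cmod (cf P' (Z k) t) <= expR (- (c * dotp t t)).
Proof.
move=> k0; have sk0 : 0 < Num.sqrt k%:R :> R by rewrite sqrtr_gt0 ltr0n.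
have [tr|rt] := leP (enorm t) (r * Num.sqrt k%:R); last first.
  by rewrite cfZ_out// Normc.normc0 expR_ge0.
rewrite cfZ Normc.normcM cmodX -[leRHS]mul1r; apply: ler_pM.
- exact: cmod_ge0.
- by rewrite exprn_ge0// cmod_ge0.
- by apply: cmod_cf_le1; exact: measurable_funPT.
have -> : expR (- (c * dotp t t)) =
    expR (- (c * dotp ((Num.sqrt k%:R)^-1 *: t) ((Num.sqrt k%:R)^-1 *: t))) ^+ k.
  rewrite -expRM_natl; congr expR; rewrite dotpZl dotpZr.
  rewrite -[X in X * - _](@sqr_sqrtr _ k%:R)//; field.
  by rewrite gt_eqF.
apply: lerXn2r; rewrite ?nnegrE ?cmod_ge0 ?expR_ge0//; apply: Xdec.
rewrite enormZ ger0_norm; last by rewrite invr_ge0 ltW.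
by rewrite mulrC ler_pdivrMr.
Qed.

Let g (t : 'rV[R]_n) : R := expR (- (dotp t t / 2)).

Let cvg_cfZ t : cmod (cf P' (Z k.+1) t - Complex (g t) 0) @[k --> \oo] --> (0 : R).
Proof.
pose a k := cf P' Y ((Num.sqrt k.+1%:R)^-1 *: t).
pose b k := cf P X ((Num.sqrt k.+1%:R)^-1 *: t).
apply: (@squeeze_cvgr _ _ _ _ (cst 0)
  (fun k => cmod (a k - 1) + cmod (b k ^+ k.+1 - Complex (g t) 0))).
- apply: nearW => k; apply/andP; split; first exact: cmod_ge0.
  have -> : cf P' (Z k.+1) t - Complex (g t) 0 =
      (a k - 1) * b k ^+ k.+1 + (b k ^+ k.+1 - Complex (g t) 0).
    by rewrite cfZ -/(a k) -/(b k); ring.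
  apply: (le_trans (cmod_triangle _ _)); rewrite lerD2r Normc.normcM cmodX.
  rewrite ler_piMr ?cmod_ge0// exprn_ile1 ?cmod_ge0//.
  by apply: cmod_cf_le1; exact: measurable_funPT.
- exact: cvg_cst.
- by rewrite -[X in _ --> X]addr0; apply: cvgD; [exact: cvg_cf_scaled|exact: cvg_cf_power].
Qed.

(** Since the cosine and the sine are bounded by 1, this dominates the difference of the two
    inversion integrands for every x at once. *)
Let D k t := `|re_cf P' (Z k) t - g t| + `|im_cf P' (Z k) t|.

Let D_le k t : D k t <= 2 * cmod (cf P' (Z k) t - Complex (g t) 0).
Proof.
have -> : cf P' (Z k) t - Complex (g t) 0 = Complex (re_cf P' (Z k) t - g t) (im_cf P' (Z k) t).
  by rewrite /cf; simpc.
by rewrite mulr_natl mulr2n; apply: lerD; [exact: cmod_ge_Re|exact: cmod_ge_Im].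
Qed.

Let mg : measurable_fun setT g.
Proof.
apply: measurableT_comp => //; apply: measurableT_comp => //; apply: measurable_funM => //.
by apply: measurable_dotp; exact: measurable_id.
Qed.

Let mD k : measurable_fun setT (D k).
Proof.
apply: measurable_funD; apply: measurableT_comp => //.
  by apply: measurable_funB => //; exact: measurable_re_cf.
exact: measurable_im_cf.
Qed.

(** The factor 2 stands for the real and the imaginary part, each bounded by the modulus. *)
Let H t := 2 * expR (- (c * dotp t t)) + g t.

Let ig : lebn.-integrable setT (EFin \o g).
Proof.
have half_gt0 : 0 < 2^-1 :> R by rewrite invr_gt0.
have := integrable_expR_dotp n half_gt0.
by apply: eq_integrable => // t _; rewrite /g /= mulrC.
Qed.

Let iH : lebn.-integrable setT (EFin \o H).
Proof.
have := integrableD measurableT (integrableZl measurableT 2 (integrable_expR_dotp n c0)) ig.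
by apply: eq_integrable.
Qed.

Let D_le_H k t : (0 < k)%N -> `|D k t| <= H t.
Proof.
move=> k0; rewrite ger0_norm ?addr_ge0//.
have le1 := cfZ_le t k0.
have h1 := le_trans (cmod_ge_Re (re_cf P' (Z k) t) (im_cf P' (Z k) t)) le1.
have h2 := le_trans (cmod_ge_Im (re_cf P' (Z k) t) (im_cf P' (Z k) t)) le1.
have h3 := ler_normB (re_cf P' (Z k) t) (g t).
have g0 : `|g t| = g t by rewrite ger0_norm// expR_ge0.
rewrite /D /H; lra.
Qed.

Let iD k : (0 < k)%N -> lebn.-integrable setT (EFin \o D k).
Proof. by move=> k0; apply: le_Rintegrable (mD k) _ iH => t; exact: D_le_H. Qed.

Let cvg_D : \int[lebn]_t D k.+1 t @[k --> \oo] --> (0 : R).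
Proof.
have := @Rintegral_dominated_cvg _ _ R lebn (fun k => D k.+1) (cst 0) H (fun k => mD k.+1) _ iH
  (fun k t => @D_le_H k.+1 t isT).
rewrite (_ : \int[lebn]_t cst 0 t = 0); last by rewrite /Rintegral integral0.
apply => t; apply: (@squeeze_cvgr _ _ _ _ (cst 0)
  (fun k => 2 * cmod (cf P' (Z k.+1) t - Complex (g t) 0))).
- by apply: nearW => k; rewrite addr_ge0//= D_le.
- exact: cvg_cst.
- by rewrite -[X in _ --> X](mulr0 2); apply: cvgMr; exact: cvg_cfZ.
Qed.

Let p k := fourier_density P' (Z k).

(** The normal density is itself an inverse transform, by [gauss_rV_inversion] with s = 1, so the
    difference of the densities is a single integral. *)
Let p_sub_le k x : (0 < k)%N ->
  `|p k x - std_normal_pdf x| <= (2 * pi) ^- n * \int[lebn]_t D k t.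
Proof.
move=> k0; have tp0 : 0 <= (2 * pi) ^- n :> R.
  by rewrite invr_ge0 exprn_ge0// mulr_ge0// pi_ge0.
rewrite std_normal_pdfE gauss_rV_inversion// /p /fourier_density -mulrBr normrM.
rewrite ger0_norm// ler_wpM2l//.
have mtrig (f : R -> R) : measurable_fun setT f ->
    measurable_fun setT (fun t : 'rV[R]_n => f (dotp t x)).
  move=> mf; apply: measurableT_comp => //.
  by apply: measurable_dotp; [exact: measurable_id|exact: measurable_cst].
have mc := mtrig cos (@measurable_cos R); have ms := mtrig sin (@measurable_sin R).
pose K t := cos (dotp t x) * re_cf P' (Z k) t + sin (dotp t x) * im_cf P' (Z k) t.
pose G t := cos (dotp t x) * expR (- (1 ^+ 2 / 2 * dotp t t)).
have iG : lebn.-integrable setT (EFin \o G).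
  apply: le_Rintegrable _ _ ig.
    apply: measurable_funM => //; apply: measurableT_comp => //; apply: measurableT_comp => //.
    by apply: measurable_funM => //; apply: measurable_dotp; exact: measurable_id.
  move=> t; rewrite normrM (ger0_norm (expR_ge0 _)) /g expr1n mul1r mulrC [2^-1 * _]mulrC.
  by rewrite ler_piMr ?expR_ge0// cos_abs_le1.
have KGle t : `|K t - G t| <= D k t.
  have -> : K t - G t =
      cos (dotp t x) * (re_cf P' (Z k) t - g t) + sin (dotp t x) * im_cf P' (Z k) t.
    by rewrite /K /G /g expr1n mul1r [2^-1 * _]mulrC; ring.
  apply: (le_trans (ler_normD _ _)); rewrite !normrM; apply: lerD.
    by rewrite ler_piMl// cos_abs_le1.
  by rewrite ler_piMl// sin_abs_le1.
have mK : measurable_fun setT K.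
  by apply: measurable_funD; apply: measurable_funM => //;
    [exact: measurable_re_cf|exact: measurable_im_cf].
have mGG := integrable_measurable_real iG.
have iKG : lebn.-integrable setT (EFin \o (fun t => K t - G t)).
  by apply: le_Rintegrable _ KGle (iD k0); exact: measurable_funB.
have iK : lebn.-integrable setT (EFin \o K).
  have := integrableD measurableT iKG iG; apply: eq_integrable => // t _ /=.
  by rewrite -EFinD subrK.
rewrite -RintegralB//; apply: (le_trans (le_normr_Rintegral measurableT iKG)).
by apply: le_Rintegral => //; [exact: (integrable_norm iKG)|exact: iD].
Qed.

Theorem local_limit_theorem : exists p : nat -> 'rV[R]_n -> R,
  (forall k, (0 < k)%N -> continuous (p k) /\ has_density P' (normalized_sum Y Xs k) (p k)) /\
  (ereal_sup [set `|p k x - std_normal_pdf x|%:E | x in [set: 'rV[R]_n]]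
     @[k --> \oo] --> 0%E).
Proof.
exists p; split=> [k k0|].
  split; first exact: (continuous_fourier_density (mZ k) (supp k0)).
  exact: (has_density_fourier_density (mZ k) (supp k0)).
pose e k := (2 * pi) ^- n * \int[lebn]_t D k.+1 t.
have e0 : (e k)%:E @[k --> \oo] --> 0%E.
  apply: cvg_EFin; first exact: nearW.
  by rewrite -[X in _ --> X](mulr0 ((2 * pi) ^- n)); apply: cvgMr; exact: cvg_D.
(* The term k = 0 is dropped: there the scaling factor is the inverse of 0, that is 0, and no bound
   is available. *)
rewrite -cvg_shiftS; apply: squeeze_cvge (cvg_cst (0 : \bar R)%E) e0.
apply: nearW => k; apply/andP; split.
    apply: (@le_trans _ _ (`|p k.+1 0 - std_normal_pdf 0|%:E)); first by rewrite lee_fin.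
    by apply: ereal_sup_ubound; exists 0.
by apply: ub_ereal_sup => _ [x _ <-]; rewrite lee_fin p_sub_le.
Qed.

End local_limit.

Theorem theorem1p3 (R : realType) (d : nat) (dO : measure_display)
    (Omega : measurableType dO) (P : probability Omega R)
    (Xs : nat -> {RV P >-> 'rV[R]_d}) :
  (0 < d)%N ->
  mutually_independent Xs ->
  (forall n, same_law (Xs n) (Xs 0%N)) ->
  (forall n, mean_zero (Xs n)) ->
  (forall n, isotropic (Xs n)) ->
  [/\ exists T : R, 0 < T /\ smoothing_radius (Xs 0%N) T,
      (beta3 (Xs 0%N) < +oo)%E ->
        smoothing_radius (Xs 0%N) (fine (beta3 (Xs 0%N)))^-1 &
      nonlattice (Xs 0%N) ->
        forall T : R, 0 < T -> smoothing_radius (Xs 0%N) T].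
Proof.
move=> d0 _ _ X0 Xiso.
(* Each part now only has to supply a Gaussian bound: c = 1/4 near 0, c = 1/6 for 1/beta3, and a
   constant from compactness in the non-lattice case. *)
have key T c : 0 < c -> cf_decay P (Xs 0%N) T c -> smoothing_radius (Xs 0%N) T.
  move=> c0 dec dO' Omega' P' Xs' Y iX lX iY Y0.
  exact: (local_limit_theorem (X0 0%N) (Xiso 0%N) c0 dec).
split.
- have [T T0 dec] := cf_decay_exists (X0 0%N) (Xiso 0%N).
  by exists T; split=> //; apply: key dec; lra.
- move=> bfin; apply: key (cf_decay_beta3 (X0 0%N) (Xiso 0%N) d0 bfin); lra.
- move=> Xnl T T0; have [c c0 dec] := cf_decay_nonlattice (X0 0%N) (Xiso 0%N) T0 Xnl.
  exact: key dec.
Qed.
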